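(* Let $x\in\mathbb{W}$ and $n\in\mathbb{N}=\{1,2,\dots\}$. If $\mathbb{E}(\tau)<\infty$, then $h^{\uparrow}$ is subharmonic and $$\mathbb{E}^{Q}_x\big(h^{\uparrow}(X_n)\mathbf{1}\{n<\zeta\}\big)<h^{\uparrow}(x).$$ If $\mathbb{E}(\tau)=\infty$, then $h^{\uparrow}$ is harmonic and $$\mathbb{E}^{Q}_x\big(h^{\uparrow}(X_n)\mathbf{1}\{n<\zeta\}\big)=h^{\uparrow}(x).$$
   Context: Let $X=(X^1,X^2,X^3)$ be a random walk on $\mathbb{R}^3$ (i.i.d. increments; the components may be dependent and have different distributions). Under $\mathbb{P}$ (expectation $\mathbb{E}$) it starts at $X_0=0$; under $\mathbb{P}_x$ (expectation $\mathbb{E}_x$) it starts at $x$. $\mathcal{F}_n=\sigma(X_1,\dots,X_n)$. $\mathbb{W}=\{x\in\mathbb{R}^3:x_1<x_2<x_3\}$. $Y=(Y^1,Y^2)=(X^2-X^1,X^3-X^2)$, $\overline{Y}^k_n=\max\{Y^k_j:0\le j\le n\}$, $\overline{Y}_n=(\overline{Y}^1_n,\overline{Y}^2_n)$. An inequality $a<b$ between vectors means strict inequality in every component. Standing assumption: each component of $Y_1$ takes positive and negative values with positive probability. $\tau=\min\{n>0:Y^1_n\wedge Y^2_n\le0\}$, the first positive time at which $X\notin\mathbb{W}$; $\mathbb{E}(\tau)$ is for the walk started at $0$. $Q_x$ (expectation $\mathbb{E}^Q_x$) is the law of $X$ started at $x$ and killed at the first exit from $\mathbb{W}$, with lifetime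 $\zeta$: $Q_x(\Lambda,n<\zeta)=\mathbb{P}_x(\Lambda,n<\tau)$ for $n\in\mathbb{N}$ and $\Lambda\in\mathcal{F}_n$. With $J_1=\inf\{n>0:\overline{Y}^k_{n-1}<Y^k_n,\ k=1,2\}$, for $x\in\mathbb{W}$ and $y=(x_2-x_1,x_3-x_2)$, $$h^{\uparrow}(x)=1+\mathbb{E}\Big(\sum_{n=1}^{J_1-1}\mathbf{1}\{\overline{Y}_{n-1}-Y_n<y\}\Big),$$ where the right-hand side is computed for the walk started at $0$. In this paper's terminology, a function $h:\mathbb{W}\to\mathbb{R}_+$ is harmonic if $\mathbb{E}_x(h(X_1);\tau>1)=h(x)$ for all $x\in\mathbb{W}$, and a function $h$ is subharmonic if $\mathbb{E}_x(h(X_1);\tau>1)\le h(x)$ for all $x\in\mathbb{W}$.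
   Formalization: For the strict inequality when E(τ)<∞, the formal theorem assumes h↑(x)<∞ in the case P(X_1∈W)=0; without this it fails, e.g. for Y_1=(2,−1) or (−1,2) with probability 1/2 each and y=(5,5), where both sides are +∞. *)

(* Defs.v *)
From HB Require Import structures.
From mathcomp Require Import all_boot all_order all_algebra.
From mathcomp Require Import all_classical all_reals all_analysis.
From mathcomp Require Import measurable_realfun.

Set Implicit Arguments.
Unset Strict Implicit.
Unset Printing Implicit Defensive.

Import Order.TTheory GRing.Theory Num.Theory.
Import numFieldNormedType.Exports.

Local Open Scope classical_set_scope.
Local Open Scope ring_scope.
Local Open Scope ereal_scope.

(* R^3 is [3.-tuple R], which carries the product (= Borel) sigma-algebra.
   Times with values in {0, 1, ...} U {oo} are elements of [\bar R]; they are
   infima, so that a time that never occurs equals [ereal_inf set0 = +oo]. *)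

Section paths.
Variable R : realType.
Implicit Types (x : 3.-tuple R) (u v : 2.-tuple R) (w : nat -> 3.-tuple R).

Definition origin : 3.-tuple R := [tuple 0%R | i < 3].

Definition Weyl : set (3.-tuple R) :=
  [set x | (tnth x 0 < tnth x 1 < tnth x 2)%R].

Definition gap x : 2.-tuple R :=
  [tuple (tnth x 1 - tnth x 0)%R; (tnth x 2 - tnth x 1)%R].

Definition vlt u v : bool := [forall k, (tnth u k < tnth v k)%R].

Definition vsub u v : 2.-tuple R := [tuple (tnth u k - tnth v k)%R | k < 2].

(* The unit [tnth (gap (w 0)) k] of the iterated maximum is its j = 0 term. *)
Definition running_max w (n : nat) : 2.-tuple R :=
  [tuple \big[Num.max/tnth (gap (w 0%N)) k]_(0 <= j < n.+1) tnth (gap (w j)) k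
  | k < 2].

Definition hitting_time (A : set nat) : \bar R :=
  ereal_inf [set n%:R%:E | n in [set n | (0 < n)%N /\ A n]].

Definition exit_time w : \bar R :=
  hitting_time [set n |
    (Num.min (tnth (gap (w n)) 0) (tnth (gap (w n)) 1) <= 0)%R].

Definition joint_record_time w : \bar R :=
  hitting_time [set n | vlt (running_max w n.-1) (gap (w n))].

End paths.

Arguments origin {R}.
Arguments Weyl {R}.

Section walk.
Context {d} {T : measurableType d} {R : realType}.
Variable P : probability T R.
Variable xi : nat -> {RV P >-> 3.-tuple R}.

(* Each [xi i] is R^3-valued: independence is over [i] only, and the three
   components of one increment are arbitrarily dependent. *)
Definition iid : Prop :=
  (forall (s : seq nat) (B : nat -> set (3.-tuple R)), uniq s ->
     (forall i, measurable (B i)) ->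
     P (\bigcap_(i in [set` s]) (xi i @^-1` B i)) =
     \prod_(i <- s) P (xi i @^-1` B i)) /\
  (forall i (B : set (3.-tuple R)), measurable B ->
     P (xi i @^-1` B) = P (xi 0%N @^-1` B)).

(* The law of [walk x] under [P] is the law of X under P_x. *)
Definition walk (x : 3.-tuple R) (t : T) (n : nat) : 3.-tuple R :=
  [tuple (tnth x i + \sum_(0 <= j < n) tnth (xi j t) i)%R | i < 3].

Definition two_sided : Prop := forall k : 'I_2,
  0 < P [set t | (0 < tnth (gap (walk origin t 1)) k)%R] /\
  0 < P [set t | (tnth (gap (walk origin t 1)) k < 0)%R].

Definition mean_exit_time : \bar R :=
  \int[P]_t exit_time (walk origin t).

(* This can be +oo, e.g. when the increment of Y is (2, -1) or (-1, 2) with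
   probability 1/2 each and [gap x = (5, 5)]. *)
Definition hup (x : 3.-tuple R) : \bar R :=
  1 + \int[P]_t
    \sum_(1 <= n <oo | n%:R%:E < joint_record_time (walk origin t))
      (vlt (vsub (running_max (walk origin t) n.-1) (gap (walk origin t n)))
         (gap x))%:R%:E.

(* E_x(h(X_1); tau > 1). *)
Definition killed_step (h : 3.-tuple R -> \bar R) (x : 3.-tuple R) : \bar R :=
  \int[P]_(t in [set t | 1 < exit_time (walk x t)]) h (walk x t 1).

Definition walk_harmonic (h : 3.-tuple R -> \bar R) : Prop :=
  (forall x, Weyl x -> 0 <= h x < +oo) /\
  (forall x, Weyl x -> killed_step h x = h x).

(* The inequality points the way it does for what is more commonly called a
   superharmonic function. *)
Definition walk_subharmonic (h : 3.-tuple R -> \bar R) : Prop :=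
  (forall x, Weyl x -> 0 <= h x) /\
  (forall x, Weyl x -> killed_step h x <= h x).

(* Under [Q], the process [X] with lifetime [zeta] has the law Q_x of the walk
   started at [x] and killed at its first exit from the chamber: the events of
   F_n = sigma(X_1, ..., X_n) are the {(X_1, ..., X_n) \in B}, with [B]
   measurable.  After [zeta] the variables [X n] are unconstrained. *)
Definition killed_law (x : 3.-tuple R) {d'} {T' : measurableType d'}
    (Q : probability T' R) (X : nat -> {RV Q >-> 3.-tuple R})
    (zeta : T' -> \bar R) : Prop :=
  {ae Q, forall t, X 0%N t = x} /\
  (forall (n : nat) (B : set (n.-tuple (3.-tuple R))),
     (0 < n)%N -> measurable B ->
     Q [set t | B [tuple X i.+1 t | i < n] /\ n%:R%:E < zeta t] =
     P [set t | B [tuple walk x t i.+1 | i < n] /\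
                n%:R%:E < exit_time (walk x t)]).

End walk.

Definition killed_expectation {d'} {T' : measurableType d'} {R : realType}
    (Q : probability T' R) (X : nat -> {RV Q >-> 3.-tuple R})
    (zeta : T' -> \bar R) (h : 3.-tuple R -> \bar R) (n : nat) : \bar R :=
  \int[Q]_t (h (X n t) * (\1_[set s | (n%:R%:E < zeta s)%E] t)%:E).

(* Main.v *)
(* Write Y for the walk of gaps, y for the gap vector of x, and J for the first
   joint record time.  Reversing the first n increments turns the event
     {n < J, max_(j < n) Y_j - Y_n < y}
   into the event that y + Y stays positive up to time n and no time i in [0, n)
   satisfies Y_m > Y_i for all m in (i, n].  After one step of the killed walk the
   same sum of probabilities appears, except that i = 0 is now allowed; the
   additional event has, after reversal, the probability of {J = n}.  Hence
     E_x(h(X_1); tau > 1) + 1 = h(x) + P(J < oo).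
   Reversal also gives P(tau > n) = P(n is a joint record), so that E(tau) is the
   mean number of joint records (time 0 included) and the renewal equation
   E(tau) = 1 + P(J < oo) E(tau) shows that E(tau) = oo iff P(J < oo) = 1.
   Finally h < oo as soon as Y_1 > 0 has positive probability: whenever
   max_(j < n) Y_j - Y_n < y, a bounded number of large positive steps produces a
   joint record, so the expected number of such n < J is finite. *)

Require Import Defs.
From HB Require Import structures.
From mathcomp Require Import all_boot all_order all_algebra.
From mathcomp Require Import all_classical all_reals all_analysis.
From mathcomp Require Import measurable_realfun.
From mathcomp Require Import ring lra zify.

Set Implicit Arguments.
Unset Strict Implicit.
Unset Printing Implicit Defensive.

Import Order.TTheory GRing.Theory Num.Theory.

Local Open Scope classical_set_scope.
Local Open Scope ring_scope.
Local Open Scope ereal_scope.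

(** * Laws of blocks of independent increments *)

Section tuple_laws.
Context {d'} {V : measurableType d'} {R : realType}.

Definition box n (B : nat -> set V) : set (n.-tuple V) :=
  [set u | forall i : 'I_n, B i (tnth u i)].
Arguments box : clear implicits.

Lemma measurable_box n (B : nat -> set V) :
  (forall i, measurable (B i)) -> measurable (box n B).
Proof.
move=> mB; rewrite (_ : box n B =
    \bigcap_(i in [set: 'I_n]) ((fun u : n.-tuple V => tnth u i) @^-1` B i)).
  apply: fin_bigcap_measurable => // i _; rewrite -[X in measurable X]setTI.
  exact: measurable_tnth.
by apply/seteqP; split=> [u Bu i _|u Bu i]; exact: Bu.
Qed.

(** Boxes are stable under intersection and generate the product sigma-algebra, so two measures that
    agree on boxes coincide once the total mass is finite. *)
Lemma tuple_measure_unique n (m1 m2 : {measure set (n.-tuple V) -> \bar R}) :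
  m1 setT < +oo ->
  (forall B, (forall i, measurable (B i)) -> m1 (box n B) = m2 (box n B)) ->
  forall A, measurable A -> m1 A = m2 A.
Proof.
move=> m1oo m12.
pose G := [set A | exists2 B, forall i, measurable (B i) & A = box n B].
have GT : G setT.
  by exists (fun=> setT) => //; apply/seteqP; split.
apply: (measure_unique G (fun=> setT)) => //.
- apply/seteqP; split; last first.
    apply: smallest_sub; first exact: sigma_algebra_measurable.
    by move=> _ [B mB ->]; exact: measurable_box.
  rewrite {1}/measurable/=; apply: smallest_sub; first exact: smallest_sigma_algebra.
  move=> A; rewrite -bigcup_seq => -[i _ [B mB <-]].
  (* A coordinate preimage is a box whose other sides are the whole space. *)
  apply: sub_sigma_algebra; exists (fun j => if j == i :> nat then B else setT).
    by move=> j; case: ifP.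
  apply/seteqP; split=> [u [_ Bu] j|u /(_ i)]; last by rewrite /= eqxx => Bu; split.
  by case: ifPn => // /eqP/val_inj ->.
- move=> _ _ [B mB ->] [C mC ->]; exists (fun i => B i `&` C i).
    by move=> i; exact: measurableI.
  apply/seteqP; split=> [u [Bu Cu] i|u BCu]; first by split; [exact: Bu|exact: Cu].
  by split=> i; have [] := BCu i.
- by rewrite bigcup_const.
- by move=> _ [B mB ->]; exact: m12.
Qed.

End tuple_laws.
Arguments box {d' V} n B.

(** The pushforward packed as a measure, with the measurability proof [mf] supplied by hand. *)
Definition image_measure {d1 d2} {T1 : measurableType d1}
    {T2 : measurableType d2} {R : realType} (m : {measure set T1 -> \bar R})
    (f : T1 -> T2) (mf : measurable_fun setT f) : {measure set T2 -> \bar R} :=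
  measure_function_pushforward__canonical__measure_function_Measure m mf.

Lemma tuple_law_unique {d1 d2 d'} {T1 : measurableType d1}
    {T2 : measurableType d2} {V : measurableType d'} {R : realType}
    (m1 : {measure set T1 -> \bar R}) (m2 : {measure set T2 -> \bar R}) n
    (U1 : T1 -> n.-tuple V) (U2 : T2 -> n.-tuple V) :
    measurable_fun setT U1 -> measurable_fun setT U2 ->
    m1 setT < +oo ->
    (forall B, (forall i, measurable (B i)) ->
       m1 [set t | box n B (U1 t)] = m2 [set t | box n B (U2 t)]) ->
  forall A, measurable A -> m1 [set t | A (U1 t)] = m2 [set t | A (U2 t)].
Proof.
move=> mU1 mU2 m1oo m12 A mA.
exact: (@tuple_measure_unique _ _ _ _ (image_measure m1 mU1)
  (image_measure m2 mU2)).
Qed.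

Definition window {V} (e : nat -> V) n : n.-tuple V := [tuple e i | i < n].

Section independence.
Context {d} {T : measurableType d} {R : realType} {P : probability T R}.
Context {xi : nat -> {RV P >-> 3.-tuple R}}.
Hypothesis hiid : iid xi.
Implicit Types (sg : nat -> nat) (B : nat -> set (3.-tuple R)).

Lemma measurable_window {d1} {T1 : measurableType d1} {d2} {V : measurableType d2}
    (e : T1 -> nat -> V) n :
  (forall j, measurable_fun setT (e^~ j)) ->
  measurable_fun setT (fun t => window (e t) n).
Proof.
move=> me; apply/measurable_fun_tnthP => i.
rewrite (_ : _ \o _ = e^~ i) //.
by apply/funext => t; rewrite /= tnth_mktuple.
Qed.

Lemma measurable_xi j : measurable_fun setT (xi j).
Proof. exact: measurable_funP. Qed.

Lemma iid_box sg n B :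
  {in gtn n &, injective sg} -> (forall i, measurable (B i)) ->
  P [set t | box n B (window (fun j => xi (sg j) t) n)] =
  \prod_(0 <= i < n) P (xi 0%N @^-1` B i).
Proof.
move=> sgI mB; pose s := [seq sg i | i <- iota 0 n].
(* [iid] labels the sets by the increment, [B] by the position in the window; [index] translates one
   labelling into the other. *)
pose C j := B (index j s).
have us : uniq s.
  rewrite map_inj_in_uniq ?iota_uniq// => i j.
  by rewrite !mem_iota/= add0n => ? ?; exact: sgI.
have Cs i : (i < n)%N -> C (sg i) = B i.
  move=> ni; rewrite /C; congr B.
  have -> : sg i = nth 0%N s i by rewrite (nth_map 0%N) ?size_iota// nth_iota.
  by rewrite index_uniq// size_map size_iota.
have [/(_ s C us (fun=> mB _)) + idd] := hiid.
rewrite big_map => prodC.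
transitivity (\prod_(0 <= i < n) P (xi (sg i) @^-1` C (sg i))); last first.
  by apply: eq_big_nat => i /andP[_ ni]; rewrite idd ?Cs.
rewrite /index_iota subn0 -prodC; congr (P _).
apply/seteqP; split=> [t Bt j /=|t Bt i].
- case/mapP => i; rewrite mem_iota/= add0n => ni ->.
  by rewrite Cs//; have := Bt (Ordinal ni); rewrite tnth_mktuple.
- rewrite tnth_mktuple -Cs//; apply: Bt => /=.
  by rewrite map_f// mem_iota add0n ltn_ord.
Qed.

Lemma measurable_xi_window sg n :
  measurable_fun setT (fun t => window (fun j => xi (sg j) t) n).
Proof. by apply: measurable_window => j; exact: measurable_xi. Qed.

(** The probability of a box does not depend on which distinct increments fill the window. Time
    reversal and shifts are the two uses. *)
Lemma window_law sg n (A : set (n.-tuple (3.-tuple R))) :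
  {in gtn n &, injective sg} -> measurable A ->
  P [set t | A (window (fun j => xi (sg j) t) n)] =
  P [set t | A (window (fun j => xi j t) n)].
Proof.
move=> sgI mA.
apply: (@tuple_law_unique _ _ _ _ _ _ _ P P n _ _ (@measurable_xi_window sg n)
  (@measurable_xi_window id n) _ _ A) => //.
  exact: (le_lt_trans (probability_le1 P measurableT) (ltry _)).
by move=> B mB; rewrite [LHS]iid_box// [RHS](@iid_box id).
Qed.

(** For fixed [E] both sides are finite measures in [A], namely P restricted to [E] and P scaled by
    P(E), so agreement on boxes suffices. *)
Lemma indep_window sg n (A : set (n.-tuple (3.-tuple R))) (E : set T) :
    measurable A -> measurable E ->
    (forall B, (forall i, measurable (B i)) ->
      P ([set t | box n B (window (fun j => xi (sg j) t) n)] `&` E) =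
      P [set t | box n B (window (fun j => xi (sg j) t) n)] * P E) ->
  P ([set t | A (window (fun j => xi (sg j) t) n)] `&` E) =
  P [set t | A (window (fun j => xi (sg j) t) n)] * P E.
Proof.
move=> mA mE BE.
have PE0 : (0 <= fine (P E))%R by rewrite fine_ge0.
pose r : {nonneg R} := NngNum PE0.
have PEr : P E = r%:num%:E by rewrite /= fineK ?fin_num_measure.
rewrite PEr muleC.
apply: (@tuple_law_unique _ _ _ _ _ _ _ (mrestr P mE) (mscale r P) n _ _
  (@measurable_xi_window sg n) (@measurable_xi_window sg n) _ _ A) => //.
  by rewrite /= /mrestr setTI (le_lt_trans (probability_le1 P mE) (ltry _)).
by move=> B mB; rewrite /= /mrestr BE// /mscale muleC PEr.
Qed.

(** The extension from boxes is applied to each block in turn; two boxes then join into a single box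
    of length n + m. *)
Lemma block_indep n m (A : set (n.-tuple (3.-tuple R)))
    (B : set (m.-tuple (3.-tuple R))) :
  measurable A -> measurable B ->
  P ([set t | A (window (fun j => xi j t) n)] `&`
     [set t | B (window (fun j => xi (n + j)%N t) m)]) =
  P [set t | A (window (fun j => xi j t) n)] *
  P [set t | B (window (fun j => xi j t) m)].
Proof.
move=> mA mB.
have mU sg k (C : set (k.-tuple (3.-tuple R))) : measurable C ->
    measurable [set t | C (window (fun j => xi (sg j) t) k)].
  by move=> mC; rewrite -[X in measurable X]setTI; exact: measurable_xi_window.
have addI : {in gtn m &, injective (addn n)} by move=> i j _ _ /addnI.
rewrite -(window_law addI)//.
apply: (@indep_window id) => // [|B1 mB1]; first exact: mU.
rewrite setIC muleC; apply: (@indep_window (addn n)) => // [|B2 mB2].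
  by apply: (mU id); exact: measurable_box.
rewrite [in RHS]iid_box// (@iid_box id)//.
pose B12 i := if (i < n)%N then B1 i else B2 (i - n)%N.
have mB12 i : measurable (B12 i) by rewrite /B12; case: ifP.
transitivity (P [set t | box (n + m) B12 (window (fun j => xi j t) (n + m))]).
  congr (P _); apply/seteqP; split=> [t [/= B2t B1t] i|t Bt].
    rewrite tnth_mktuple /B12; case: ltnP => [ni|ni].
      by have := B1t (Ordinal ni); rewrite tnth_mktuple.
    have im : (i - n < m)%N by rewrite ltn_subLR.
    by have := B2t (Ordinal im); rewrite tnth_mktuple/= subnKC.
  split=> i /=.
    have := Bt (rshift n i); rewrite !tnth_mktuple/= /B12.
    by rewrite ltnNge leq_addr/= addKn.
  by have := Bt (lshift m i); rewrite !tnth_mktuple/= /B12 ltn_ord.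
rewrite (@iid_box id)// (@big_cat_nat _ _ _ n)//= ?leq_addr// muleC; congr (_ * _).
  rewrite -[X in \prod_(X <= i < _) _]add0n big_addn addKn; apply: eq_bigr => i _.
  by rewrite /B12 ltnNge leq_addl/= addnK.
by apply: eq_big_nat => i /andP[_ ni]; rewrite /B12 ni.
Qed.

(** The first increment is independent of the next n, which are distributed as the first n; the
    joint law is a product and Tonelli's theorem applies. *)
Lemma ge0_integral_first_step n (g : 3.-tuple R * n.-tuple (3.-tuple R) -> \bar R) :
    measurable_fun setT g -> (forall z, 0 <= g z) ->
  \int[P]_t g (xi 0%N t, window (fun j => xi j.+1 t) n) =
  \int[P]_t \int[P]_s g (xi 0%N t, window (fun j => xi j s) n).
Proof.
move=> mg g0.
have mxi0 := measurable_xi 0; have mW := @measurable_xi_window id n.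
have mS := @measurable_xi_window succn n.
have mpair : measurable_fun setT
    (fun t => (xi 0%N t, window (fun j => xi j.+1 t) n)) by exact: measurable_fun_pair.
pose mWm := isMeasurableFun.Build _ _ _ _ _ mW.
pose W : {mfun T >-> n.-tuple (3.-tuple R)} := HB.pack (fun t => _) mWm.
pose mu1 := distribution P (xi 0%N).
pose mu2 := distribution P W.
transitivity (\int[image_measure P mpair]_z g z).
  by rewrite ge0_integral_pushforward.
transitivity (\int[mu1 \x mu2]_z g z).
  apply: eq_measure_integral => A mA _.
  apply/esym/product_measure_unique => // B C mB mC.
  (* Read as a set of 1-tuples, [B] becomes an event of a block of length 1. *)
  pose B1 := (fun u : 1.-tuple (3.-tuple R) => tnth u ord0) @^-1` B.
  have mB1 : measurable B1.
    by rewrite -[X in measurable X]setTI; exact: measurable_tnth.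
  have B1E : [set t | B1 (window (fun j => xi j t) 1)] = xi 0%N @^-1` B.
    by apply/seteqP; split=> t; rewrite /B1 /= tnth_mktuple.
  by have := block_indep mB1 mC; rewrite B1E.
rewrite fubini_tonelli1//.
rewrite ge0_integral_distribution//; last 2 first.
- exact: measurable_fun_fubini_tonelli_F.
- by move=> ?; exact: integral_ge0.
apply: eq_integral => t _ /=; rewrite /fubini_F ge0_integral_distribution//.
exact: measurableT_comp.
Qed.

End independence.

(** * Records and time reversal of a path *)

Section paths.
Context {R : realType}.
Implicit Types (x v : 3.-tuple R) (y : 2.-tuple R) (e : nat -> 3.-tuple R).

Definition vadd x v : 3.-tuple R := [tuple (tnth x i + tnth v i)%R | i < 3].

Definition path x e n : 3.-tuple R :=
  [tuple (tnth x i + \sum_(0 <= j < n) tnth (e j) i)%R | i < 3].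

(* [psum e k n] is Y^(k+1)_n for the walk with increments [e] started at 0. *)
Definition psum e (k : 'I_2) n : R := (\sum_(0 <= j < n) tnth (gap (e j)) k)%R.

(** Vacuous at n = 0, so that time 0 counts as a joint record. *)
Definition is_record e n := forall (k : 'I_2) j, (j < n)%N ->
  (psum e k j < psum e k n)%R.

Definition near_max y e n := forall (k : 'I_2) j, (j < n)%N ->
  (psum e k j - psum e k n < tnth y k)%R.

Definition no_record e n := forall m, (0 < m <= n)%N -> ~ is_record e m.

Definition survives y e n := forall m, (0 < m <= n)%N ->
  forall k : 'I_2, (0 < tnth y k + psum e k m)%R.

(* [a = 0] is the n-th event of [hup], [a = 1] leaves time n free to be a record,
   and [a = n] drops the record condition altogether; [forward] is the image of
   [backward] under reversal of the first n increments. *)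
Definition backward a n y e := near_max y e n /\
  forall m, (0 < m)%N -> (m + a <= n)%N -> ~ is_record e m.

Definition forward a n y e := survives y e n /\
  forall i, (a <= i < n)%N -> ~ (forall (k : 'I_2) m, (i < m <= n)%N ->
     (psum e k i < psum e k m)%R).

Lemma tnth_gap x (k : 'I_2) :
  tnth (gap x) k = (tnth x (lift ord0 k) - tnth x (widen_ord (leqnSn 2) k))%R.
Proof.
by case: k => -[|[|//]] ?; rewrite /gap !(tnth_nth 0%R)/=.
Qed.

Lemma psum0 e k : psum e k 0 = 0%R.
Proof. by rewrite /psum big_geq. Qed.

Lemma psumS e k n : psum e k n.+1 = (psum e k n + tnth (gap (e n)) k)%R.
Proof. by rewrite /psum big_nat_recr. Qed.

Lemma psumSl e k n :
  psum e k n.+1 = (tnth (gap (e 0%N)) k + psum (e \o succn) k n)%R.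
Proof. by rewrite /psum big_nat_recl. Qed.

Lemma psumD e k m n :
  psum e k (m + n) = (psum e k m + psum (e \o addn m) k n)%R.
Proof.
elim: n => [|n IH]; first by rewrite addn0 psum0 addr0.
by rewrite addnS !psumS IH addrA.
Qed.

Lemma eq_psum e e' k n : (forall j, (j < n)%N -> e j = e' j) ->
  psum e k n = psum e' k n.
Proof. by move=> ee; apply: eq_big_nat => j /andP[_ /ee->]. Qed.

Lemma gap_path x e n k : tnth (gap (path x e n)) k = (tnth (gap x) k + psum e k n)%R.
Proof.
rewrite !tnth_gap !tnth_mktuple /psum.
under [in RHS]eq_bigr do rewrite tnth_gap.
by rewrite sumrB; ring.
Qed.

Lemma gap_vadd x v k : tnth (gap (vadd x v)) k = (tnth (gap x) k + tnth (gap v) k)%R.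
Proof. by rewrite !tnth_gap !tnth_mktuple; ring. Qed.

Lemma gap_origin k : tnth (gap (origin : 3.-tuple R)) k = 0%R.
Proof. by rewrite tnth_gap !tnth_mktuple subrr. Qed.

Lemma path1 x e : path x e 1 = vadd x (e 0%N).
Proof. by apply/eq_from_tnth => i; rewrite !tnth_mktuple big_nat1. Qed.

Lemma pathS x e n : path x e n.+1 = path (vadd x (e 0%N)) (e \o succn) n.
Proof. by apply/eq_from_tnth => i; rewrite !tnth_mktuple big_nat_recl//= addrA. Qed.

Lemma I2P (Q : 'I_2 -> Prop) : (forall k, Q k) <-> Q 0%R /\ Q 1%R.
Proof.
split=> [//|[Q0 Q1] [[|[|//]] k2]].
  by rewrite (_ : Ordinal k2 = 0%R)//; exact/val_inj.
by rewrite (_ : Ordinal k2 = 1%R)//; exact/val_inj.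
Qed.

Lemma WeylP x : Weyl x <-> forall k, (0 < tnth (gap x) k)%R.
Proof.
rewrite I2P /Weyl /=.
have -> : tnth (gap x) 0%R = (tnth x 1 - tnth x 0)%R by [].
have -> : tnth (gap x) 1%R = (tnth x 2 - tnth x 1)%R by [].
by rewrite !subr_gt0; split=> /andP.
Qed.

Lemma hitting_timeP (A : set nat) n :
  n%:R%:E < hitting_time R A <-> forall m, (0 < m <= n)%N -> ~ A m.
Proof.
split=> [nA m /andP[m0 mn] Am|nA].
  have : hitting_time R A <= m%:R%:E by apply: ereal_inf_lbound; exists m.
  by move=> /(lt_le_trans nA); rewrite lte_fin ltr_nat ltnNge mn.
(* Every hit occurs at time n + 1 or later, so n + 1 is a lower bound; this includes the empty set,
   whose infimum is +oo. *)
apply: (@lt_le_trans _ _ n.+1%:R%:E); first by rewrite lte_fin ltr_nat.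
apply: le_ereal_inf_tmp => _ [m [m0 Am] <-]; rewrite lee_fin ler_nat ltnNge.
by apply/negP => mn; apply: (nA m) => //; rewrite m0.
Qed.

Lemma exit_timeP x e n :
  n%:R%:E < exit_time (path x e) <-> survives (gap x) e n.
Proof.
rewrite /exit_time hitting_timeP; split=> + m mn => /(_ m mn).
  move=> /negP; rewrite -ltNge lt_min => /andP[h0 h1] k.
  by move: k; apply/I2P; rewrite -!gap_path.
by move=> /I2P[]; rewrite -!gap_path => h0 h1; apply/negP; rewrite -ltNge lt_min h0.
Qed.

Lemma vltP (u v : 2.-tuple R) :
  reflect (forall k, (tnth u k < tnth v k)%R) (vlt u v).
Proof. exact: forallP. Qed.

Lemma running_max_lt (w : nat -> 3.-tuple R) n k (c : R) :
  (tnth (running_max w n) k < c)%R <->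
  forall j, (j < n.+1)%N -> (tnth (gap (w j)) k < c)%R.
Proof.
rewrite tnth_mktuple big_mkord; split=> [/bigmax_ltP[_ h] j jn|h].
  exact: (h (Ordinal jn)).
by apply/bigmax_ltP; split=> [|i _]; exact: h.
Qed.

Lemma is_recordP e n : (0 < n)%N ->
  vlt (running_max (path origin e) n.-1) (gap (path origin e n)) <->
  is_record e n.
Proof.
move=> n0; split=> [/vltP h k j jn|h].
  have /running_max_lt/(_ j) := h k; rewrite prednK// => /(_ jn).
  by rewrite !gap_path !gap_origin !add0r.
apply/vltP => k; apply/running_max_lt => j; rewrite prednK// => jn.
by rewrite !gap_path !gap_origin !add0r; exact: h.
Qed.

Lemma near_maxP y e n : (0 < n)%N ->
  vlt (vsub (running_max (path origin e) n.-1) (gap (path origin e n))) y <->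
  near_max y e n.
Proof.
move=> n0; split=> [/vltP h k j jn|h].
  have := h k; rewrite tnth_mktuple ltrBlDr => /running_max_lt/(_ j).
  by rewrite prednK// => /(_ jn); rewrite !gap_path !gap_origin !add0r ltrBlDr.
apply/vltP => k; rewrite tnth_mktuple ltrBlDr; apply/running_max_lt => j.
by rewrite prednK// => jn; rewrite !gap_path !gap_origin !add0r -ltrBlDr; exact: h.
Qed.

Lemma joint_record_timeP e n :
  n%:R%:E < joint_record_time (path origin e) <-> no_record e n.
Proof.
rewrite /joint_record_time hitting_timeP; split=> h m mn.
  by move=> /is_recordP-/(_ (proj1 (andP mn))); exact: h.
by move=> /is_recordP-/(_ (proj1 (andP mn))); exact: h.
Qed.

Definition rev_index n j := if (j < n)%N then (n - j.+1)%N else j.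

Lemma rev_index_inj n : {in gtn n &, injective (rev_index n)}.
Proof.
by move=> i j; rewrite !inE /rev_index => /[dup] ? -> /[dup] ? -> ?; lia.
Qed.

(** The first i reversed increments are the last i among the first n. *)
Lemma psum_rev e k n i : (i <= n)%N ->
  psum (e \o rev_index n) k i = (psum e k n - psum e k (n - i))%R.
Proof.
elim: i => [|i IH] ni; first by rewrite psum0 subn0 subrr.
rewrite psumS IH 1?ltnW//= /rev_index ni -(subnSK ni) psumS; ring.
Qed.

(** Let Y'_i = Y_n - Y_(n-i) be the reversed walk. Then Y'_j - Y'_n = -Y_(n-j), so [near_max] for Y'
    is survival for Y; and m is a record of Y' exactly when Y stays above Y_(n-m) after time n - m.
    The bound m + a <= n becomes a <= i for i = n - m. *)
Lemma forward_rev a n y e :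
  forward a n y e <-> backward a n y (e \o rev_index n).
Proof.
split=> [[h1 h2]|[h1 h2]]; split.
- move=> k j jn; rewrite !psum_rev// 1?ltnW// subnn psum0.
  have := h1 (n - j)%N; rewrite subn_gt0 jn leq_subr => /(_ isT k).
  lra.
- move=> m m0 mn rm; apply: (h2 (n - m)%N); first lia.
  move=> k i /andP[mi ni]; have := rm k (n - i)%N.
  rewrite !psum_rev; [|lia|lia]; rewrite subKn// ltrD2l ltrN2.
  by apply; lia.
- move=> m /andP[m0 mn] k; have := h1 k (n - m)%N.
  rewrite !psum_rev ?leq_subr// subKn// subnn psum0 => /(_ ltac:(lia)); lra.
- move=> i /andP[ai ni] h; apply: (h2 (n - i)%N); [lia|lia|].
  move=> k j jn; rewrite psum_rev; last lia. rewrite psum_rev; last lia.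
  by rewrite subKn 1?ltnW// ltrD2l ltrN2; apply: h; lia.
Qed.

(** Path events up to time n depend on the first n increments alone, here and in the next three
    lemmas; this lets them be read as sets of n-tuples. *)
Lemma eq_is_record e e' n : (forall j, (j < n)%N -> e j = e' j) ->
  is_record e n -> is_record e' n.
Proof.
move=> ee h k j jn; rewrite -!(@eq_psum e)//; first exact: h.
by move=> i ij; apply: ee; exact: ltn_trans jn.
Qed.

Lemma eq_backward a n y e e' : (forall j, (j < n)%N -> e j = e' j) ->
  backward a n y e -> backward a n y e'.
Proof.
move=> ee [h1 h2]; split=> [k j jn|m m0 mn rm].
  rewrite -!(@eq_psum e)//; first exact: h1.
  by move=> i ij; apply: ee; exact: ltn_trans jn.
apply: (h2 m) => //; apply: eq_is_record rm => j jm; apply/esym/ee; lia.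
Qed.

Lemma eq_forward a n y e e' : (forall j, (j < n)%N -> e j = e' j) ->
  forward a n y e -> forward a n y e'.
Proof.
move=> ee /forward_rev h; apply/forward_rev; apply: eq_backward h => j jn /=.
by apply: ee; rewrite /rev_index jn; lia.
Qed.

Lemma eq_survives n y e e' : (forall j, (j < n)%N -> e j = e' j) ->
  survives y e n -> survives y e' n.
Proof.
move=> ee h m /[dup] /h{}h mn k; rewrite -(@eq_psum e)// => j jm.
by apply: ee; lia.
Qed.

End paths.

(** * Measurability and probabilities of path events *)

Section measurable_events.
Context {d} {T : measurableType d} {R : realType}.

Lemma measurable_forall_nat (A : nat -> set T) :
  (forall n, measurable (A n)) -> measurable [set t | forall n, A n t].
Proof.
move=> mA; rewrite (_ : mkset _ = \bigcap_n A n); first exact: bigcapT_measurable.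
by apply/seteqP; split=> [t At n _|t At n]; exact: At.
Qed.

Lemma measurable_forall_fin (I : finType) (A : I -> set T) :
  (forall i, measurable (A i)) -> measurable [set t | forall i, A i t].
Proof.
move=> mA; rewrite (_ : mkset _ = \bigcap_(i in setT) A i).
  exact: fin_bigcap_measurable.
by apply/seteqP; split=> [t At n _|t At n]; exact: At.
Qed.

Lemma measurable_imply (Q : Prop) (A : set T) :
  measurable A -> measurable [set t | Q -> A t].
Proof.
move=> mA; have [q|nq] := pselect Q.
  by rewrite (_ : mkset _ = A)//; apply/seteqP; split=> [t /(_ q)|t At _].
by rewrite (_ : mkset _ = setT)//; apply/seteqP; split=> t // _ /nq.
Qed.

Lemma measurable_not (A : set T) : measurable A -> measurable [set t | ~ A t].
Proof. exact: measurableC. Qed.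

Lemma measurable_and (A B : set T) :
  measurable A -> measurable B -> measurable [set t | A t /\ B t].
Proof. exact: measurableI. Qed.

Lemma measurable_lt (f g : T -> R) :
  measurable_fun setT f -> measurable_fun setT g ->
  measurable [set t | (f t < g t)%R].
Proof.
move=> mf mg; have := measurable_fun_ltr mf mg.
have mt : measurable ([set true] : set bool) by [].
by move=> /(_ measurableT _ mt); rewrite setTI.
Qed.

Variables (x v : T -> 3.-tuple R) (e : T -> nat -> 3.-tuple R).
Hypotheses (mx : measurable_fun setT x) (mv : measurable_fun setT v).
Hypothesis me : forall j, measurable_fun setT (e^~ j).

Let measurable_coord (z : T -> 3.-tuple R) i : measurable_fun setT z ->
  measurable_fun setT (fun t => tnth (z t) i).
Proof. by move=> mz; apply: (measurableT_comp (measurable_tnth i)). Qed.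

Lemma measurable_gap (z : T -> 3.-tuple R) k : measurable_fun setT z ->
  measurable_fun setT (fun t => tnth (gap (z t)) k).
Proof.
move=> mz; under eq_fun do rewrite tnth_gap.
by apply: measurable_funB; exact: measurable_coord.
Qed.

Lemma measurable_vadd : measurable_fun setT (fun t => vadd (x t) (v t)).
Proof.
apply/measurable_fun_tnthP => i.
rewrite (_ : _ \o _ = fun t => (tnth (x t) i + tnth (v t) i)%R).
  by apply: measurable_funD; exact: measurable_coord.
by apply/funext => t /=; rewrite tnth_mktuple.
Qed.

Lemma measurable_psum k n : measurable_fun setT (fun t => psum (e t) k n).
Proof. by apply: measurable_sum => j; exact: measurable_gap. Qed.

Lemma measurable_path n : measurable_fun setT (fun t => path (x t) (e t) n).
Proof.
apply/measurable_fun_tnthP => i.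
rewrite (_ : _ \o _ =
    fun t => (tnth (x t) i + \sum_(0 <= j < n) tnth (e t j) i)%R).
  apply: measurable_funD; first exact: measurable_coord.
  by apply: measurable_sum => j; exact: measurable_coord.
by apply/funext => t /=; rewrite tnth_mktuple.
Qed.

Lemma measurable_is_record n : measurable [set t | is_record (e t) n].
Proof.
apply: measurable_forall_fin => k; apply: measurable_forall_nat => j.
by apply: measurable_imply; apply: measurable_lt; exact: measurable_psum.
Qed.

Lemma measurable_survives n : measurable [set t | survives (gap (x t)) (e t) n].
Proof.
apply: measurable_forall_nat => m; apply: measurable_imply.
apply: measurable_forall_fin => k; apply: measurable_lt => //.
by apply: measurable_funD; [exact: measurable_gap|exact: measurable_psum].
Qed.

(** The start [x] may vary with the sample point: a constant [x] gives a fixed start, a projection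
    gives the joint measurability used for Tonelli's theorem. *)
Lemma measurable_backward a n :
  measurable [set t | backward a n (gap (x t)) (e t)].
Proof.
apply: measurable_and.
  apply: measurable_forall_fin => k; apply: measurable_forall_nat => j.
  apply: measurable_imply; apply: measurable_lt; last exact: measurable_gap.
  by apply: measurable_funB; exact: measurable_psum.
apply: measurable_forall_nat => m; do 2 apply: measurable_imply.
by apply: measurable_not; exact: measurable_is_record.
Qed.

Lemma measurable_Weyl : measurable [set t | Weyl (x t)].
Proof.
rewrite (_ : mkset _ = [set t | forall k, 0 < tnth (gap (x t)) k]%R).
  apply: measurable_forall_fin => k; apply: measurable_lt => //.
  exact: measurable_gap.
by apply/seteqP; split=> t /WeylP.
Qed.

End measurable_events.

Lemma measurable_forward {d} {T : measurableType d} {R : realType}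
    (x : T -> 3.-tuple R) (e : T -> nat -> 3.-tuple R) a n :
  measurable_fun setT x -> (forall j, measurable_fun setT (e^~ j)) ->
  measurable [set t | forward a n (gap (x t)) (e t)].
Proof.
move=> mx me.
rewrite (_ : mkset _ = [set t | backward a n (gap (x t)) (e t \o rev_index n)]).
  by apply: measurable_backward => // j; exact: me.
by apply/seteqP; split=> t /forward_rev.
Qed.

(** * Passing between finite windows and infinite sequences *)

Section window_seq.
Context {R : realType}.

(** Entries beyond the tuple are filled with [origin]; path events up to time n do not see them. *)
Definition seq_of n (u : n.-tuple (3.-tuple R)) j := nth origin u j.

Lemma seq_of_window e n j : (j < n)%N -> seq_of (window e n) j = e j.
Proof.
by move=> jn; rewrite /seq_of -[j]/(val (Ordinal jn)) -tnth_nth tnth_mktuple.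
Qed.

Lemma measurable_seq_of n j :
  measurable_fun setT (fun u : n.-tuple (3.-tuple R) => seq_of u j).
Proof.
have [jn|nj] := ltnP j n.
  rewrite (_ : (fun u : n.-tuple _ => seq_of u j) = fun u => tnth u (Ordinal jn)).
    exact: measurable_tnth.
  by apply/funext => u; rewrite (tnth_nth origin).
rewrite (_ : (fun u : n.-tuple _ => seq_of u j) = cst origin)//.
by apply/funext => u; rewrite /seq_of nth_default// size_tuple.
Qed.

End window_seq.

(** * Time reversal and independence for path events *)

Section walk_events.
Context {d} {T : measurableType d} {R : realType} {P : probability T R}.
Context {xi : nat -> {RV P >-> 3.-tuple R}}.
Hypothesis hiid : iid xi.
Implicit Types (x : 3.-tuple R) (t : T).

Let X t j := xi j t.

Let mX j : measurable_fun setT (X^~ j).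
Proof. exact: measurable_xi. Qed.

Lemma measurable_backward_xi a n x sg :
  measurable [set t | backward a n (gap x) (X t \o sg)].
Proof. by apply: (@measurable_backward _ _ _ (cst x)) => // j; exact: mX. Qed.

Let bset a n x : set (n.-tuple (3.-tuple R)) :=
  [set u | backward a n (gap x) (seq_of u)].
Arguments bset : clear implicits.

Let mbset a n x : measurable (bset a n x).
Proof.
apply: (@measurable_backward _ _ _ (cst x)) => // j; exact: measurable_seq_of.
Qed.

Let bsetE a n x sg : [set t | bset a n x (window (fun j => xi (sg j) t) n)] =
  [set t | backward a n (gap x) (X t \o sg)].
Proof.
apply/seteqP; split=> t; apply: eq_backward => j jn; first by rewrite seq_of_window.
by rewrite seq_of_window.
Qed.

Let bsetE_id a n x : [set t | bset a n x (window (fun j => xi j t) n)] =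
  [set t | backward a n (gap x) (X t)].
Proof. exact: (bsetE a n x id). Qed.

(** Reversal is an injective reindexing of the first n increments, so it preserves their joint law
    while exchanging the two events. *)
Lemma prob_forward a n x :
  P [set t | forward a n (gap x) (X t)] = P [set t | backward a n (gap x) (X t)].
Proof.
rewrite -[X in _ = P X]bsetE_id -(window_law hiid (@rev_index_inj n))//.
rewrite bsetE; congr (P _).
by apply/seteqP; split=> t /forward_rev.
Qed.

(** Splits the walk at time n into its past and the walk restarted there, as the renewal equation
    requires. *)
Lemma prob_backward_block a n x b m z :
  P ([set t | backward a n (gap x) (X t)] `&`
     [set t | backward b m (gap z) (X t \o addn n)]) =
  P [set t | backward a n (gap x) (X t)] * P [set t | backward b m (gap z) (X t)].
Proof.
have := block_indep hiid (@mbset a n x) (@mbset b m z).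
by rewrite !bsetE_id (bsetE b m z (addn n)).
Qed.

(** Prescribes ranges for the m increments after time n, independently of the past; the finiteness
    proof uses it to force a rise. *)
Lemma prob_backward_box a n x m (B : nat -> set (3.-tuple R)) :
  (forall i, measurable (B i)) ->
  P ([set t | backward a n (gap x) (X t)] `&`
     [set t | forall i, (i < m)%N -> B i (xi (n + i)%N t)]) =
  P [set t | backward a n (gap x) (X t)] * \prod_(0 <= i < m) P (xi 0%N @^-1` B i).
Proof.
move=> mB; rewrite -(@iid_box _ _ _ _ _ hiid id)//.
rewrite -[in RHS]bsetE_id -(block_indep hiid)//; last exact: measurable_box.
rewrite bsetE_id; congr (P (_ `&` _)); apply/seteqP; split=> t Bt i.
  by rewrite tnth_mktuple; exact: Bt.
by move=> im; have := Bt (Ordinal im); rewrite tnth_mktuple.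
Qed.

Lemma ge0_integral_first_step_seq n (g : 3.-tuple R -> (nat -> 3.-tuple R) -> \bar R) :
    (forall v e e', (forall j, (j < n)%N -> e j = e' j) -> g v e = g v e') ->
    (forall v e, 0 <= g v e) ->
    measurable_fun setT (fun z : 3.-tuple R * n.-tuple (3.-tuple R) =>
      g z.1 (seq_of z.2)) ->
  \int[P]_t g (xi 0%N t) (X t \o succn) = \int[P]_t \int[P]_s g (xi 0%N t) (X s).
Proof.
move=> gn g0 mg.
transitivity (\int[P]_t g (xi 0%N t) (seq_of (window (X t \o succn) n))).
  by apply: eq_integral => t _; apply: gn => j jn; rewrite seq_of_window.
rewrite (ge0_integral_first_step hiid mg)//.
apply: eq_integral => t _; apply: eq_integral => s _.
by apply: gn => j jn; rewrite seq_of_window.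
Qed.

End walk_events.

Lemma eq_indic {T : Type} {R : realType} (A : set T) (b : bool) (t : T) :
  (b <-> A t) -> b%:R = \1_A t :> R.
Proof.
move=> bA; rewrite indicE; congr (nat_of_bool _)%:R.
by apply/idP/idP => [/bA/mem_set|/set_mem/bA].
Qed.

(** * The harmonic function and the exit time as series *)

Section record_probabilities.
Context {d} {T : measurableType d} {R : realType} (P : probability T R).
Variable xi : nat -> {RV P >-> 3.-tuple R}.
Implicit Types (x : 3.-tuple R) (t : T).

Let X t j := xi j t.

Definition prob_backward a n x := P [set t | backward a n (gap x) (X t)].

(** For y = 0 the condition [near_max] says that n is a record, and a = n removes all other
    constraints: this is P(n is a joint record), equal to 1 at n = 0. *)
Definition record_prob n := prob_backward n n origin.

(** For n >= 1 this is P(J = n). *)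
Definition first_record_prob n := prob_backward 1 n origin.

Lemma measurable_backward_walk a n x :
  measurable [set t | backward a n (gap x) (X t)].
Proof. exact: (measurable_backward_xi a n x id). Qed.

Lemma prob_backward_ge0 a n x : 0 <= prob_backward a n x.
Proof. exact: measure_ge0. Qed.

Lemma prob_backward_le1 a n x : prob_backward a n x <= 1.
Proof. by apply: probability_le1; exact: measurable_backward_walk. Qed.

Lemma walkE x t : walk xi x t = path x (X t).
Proof. by []. Qed.

Lemma backward00 y (e : nat -> 3.-tuple R) : backward 0 0 y e.
Proof. by split=> [//|m]; rewrite addn0 leqn0 lt0n => /negPf->. Qed.

Lemma backward0P n y (e : nat -> 3.-tuple R) :
  backward 0 n y e <-> near_max y e n /\ no_record e n.
Proof.
split=> -[h1 h2]; split=> // m.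
  by move=> /andP[m0 mn]; apply: h2; rewrite ?addn0.
by rewrite addn0 => m0 mn; apply: h2; rewrite m0.
Qed.

Lemma prob_backward00 x : prob_backward 0 0 x = 1.
Proof.
rewrite /prob_backward (_ : mkset _ = setT) ?probability_setT//.
by apply/seteqP; split=> t //= _; exact: backward00.
Qed.

(** The leading 1 of h is the term n = 0, and the sum over 1 <= n < J is integrated term by term. *)
Lemma hupE x : hup xi x = \sum_(n <oo) prob_backward 0 n x.
Proof.
rewrite nneseries_recl => [|n _|//]; last exact: prob_backward_ge0.
rewrite /hup; congr (_ + _).
  by rewrite prob_backward00.
pose E n := [set t | backward 0 n (gap x) (X t)].
have mE n : measurable (E n) by exact: measurable_backward_walk.
transitivity (\int[P]_t \sum_(n <oo) (\1_(E n.+1) t)%:E).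
  apply: eq_integral => t _; rewrite eseries_mkcond -nneseries_addn; last first.
    by move=> n; case: ifP.
  apply: eq_eseriesr => n _; rewrite addn1 -(@eq_indic _ _ _
    ((n.+1%:R%:E < joint_record_time (walk xi origin t)) &&
     vlt (vsub (running_max (walk xi origin t) n) (gap (walk xi origin t n.+1)))
       (gap x))).
    by case: ifP.
  rewrite /E /= backward0P -joint_record_timeP -near_maxP// andbC.
  by split=> [/andP|[-> ->]].
rewrite integral_nneseries//; last by move=> n; exact/measurable_EFinP.
rewrite -nneseries_addn; last by move=> n; exact: prob_backward_ge0.
by apply: eq_eseriesr => n _; rewrite integral_indic// setIT addn1.
Qed.

(** The tail-sum formula before taking expectations: a time counts the integers n >= 0 below it. *)
Lemma hitting_time_series (A : set nat) :
  hitting_time R A = \sum_(n <oo) (n%:R%:E < hitting_time R A)%E%:R%:E.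
Proof.
have [nA|/existsNP[m0 /not_implyP[m00 /contrapT Am0]]] :=
    pselect (forall m, (0 < m)%N -> ~ A m).
  have lt n : n%:R%:E < hitting_time R A.
    by apply/hitting_timeP => m /andP[m0 _]; exact: nA.
  have -> : hitting_time R A = +oo.
    rewrite /hitting_time (_ : image _ _ = set0) ?ereal_inf0//.
    by rewrite -subset0 => z [m [m0 Am] _]; exact: (nA m).
  rewrite (@eq_eseriesr _ _ (fun=> 1%R%:E)) => [|i _]; last by rewrite ltry.
  (* All terms equal 1, so the partial sum of length floor(r) + 1 already exceeds r. *)
  apply/esym/eqyP => r r0; apply: le_trans (nneseries_lim_ge (Num.truncn r).+1 _) => //.
  rewrite sumEFin lee_fin sumr_const_nat subn0 -[leRHS]mulr_natr mul1r ltW//.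
  exact: truncnS_gt.
have [m [m0' Am mmin]] : exists m, [/\ (0 < m)%N, A m &
    forall i, (0 < i)%N -> A i -> (m <= i)%N].
  pose Q i := (0 < i)%N && `[< A i >].
  have exQ : exists i, Q i by exists m0; rewrite /Q m00; apply/asboolP.
  case: (ex_minnP exQ) => m /andP[m1 /asboolP Am] mmin; exists m; split => // i i0 Ai.
  by apply: mmin; rewrite /Q i0; apply/asboolP.
have ltm n : (n%:R%:E < hitting_time R A) = (n < m)%N.
  apply/idP/idP => [/hitting_timeP h|nm].
    by rewrite ltnNge; apply/negP => mn; apply: (h m) => //; rewrite m0'.
  apply/hitting_timeP => i /andP[i0 ni] Ai.
  by have := mmin _ i0 Ai; rewrite leqNgt (leq_ltn_trans ni nm).
have -> : \sum_(n <oo) (n%:R%:E < hitting_time R A)%E%:R%:E = m%:R%:E :> \bar R.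
  rewrite (@nneseries_split _ _ 0 m)//= add0n eseries0 => [|n mn _]; last first.
    by rewrite ltm ltnNge mn.
  rewrite adde0 sumEFin (@eq_big_nat _ _ _ _ _ _ (fun=> 1%R)) => [|n nm].
    by rewrite sumr_const_nat subn0.
  by rewrite ltm; case/andP: nm => _ ->.
apply/eqP; rewrite eq_le; apply/andP; split.
  by apply: ereal_inf_lbound; exists m.
apply: le_ereal_inf_tmp => _ [i [i0 Ai] <-]; rewrite lee_fin ler_nat; exact: mmin.
Qed.

Lemma backward_diag n (e : nat -> 3.-tuple R) :
  backward n n (gap origin) e <-> is_record e n.
Proof.
split=> [[h _] k j jn|h].
  by have := h k j jn; rewrite gap_origin subr_lt0.
split=> [k j jn|m]; last lia.
by rewrite gap_origin subr_lt0; exact: h.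
Qed.

Lemma forward_diag n (e : nat -> 3.-tuple R) :
  forward n n (gap origin) e <-> survives (gap origin) e n.
Proof. by split=> [[]//|h]; split=> // i; lia. Qed.

Hypothesis hiid : iid xi.

(** Reversal with y = 0 and a = n: staying positive up to n turns into n being a record. *)
Lemma record_prob_survives n :
  record_prob n = P [set t | survives (gap origin) (X t) n].
Proof.
rewrite /record_prob /prob_backward -prob_forward//; congr (P _).
by apply/seteqP; split=> t /forward_diag.
Qed.

Lemma mean_exit_timeE : mean_exit_time xi = \sum_(n <oo) record_prob n.
Proof.
pose E n := [set t | survives (gap origin) (X t) n].
have mE n : measurable (E n).
  by apply: (@measurable_survives _ _ _ (cst origin)) => // j; exact: measurable_xi.
transitivity (\int[P]_t \sum_(n <oo) (\1_(E n) t)%:E).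
  apply: eq_integral => t _; rewrite /exit_time hitting_time_series.
  by apply: eq_eseriesr => n _; congr EFin; apply: eq_indic; exact: exit_timeP.
rewrite integral_nneseries//; last by move=> n; exact/measurable_EFinP.
by apply: eq_eseriesr => n _; rewrite integral_indic// setIT record_prob_survives.
Qed.

End record_probabilities.

(** * One step of the killed walk *)

Lemma survivesS {R : realType} n (x : 3.-tuple R) e :
  survives (gap x) e n.+1 <->
  Weyl (vadd x (e 0%N)) /\ survives (gap (vadd x (e 0%N))) (e \o succn) n.
Proof.
rewrite WeylP; split=> [h|[W h]].
  split=> [k|m /andP[m0 mn] k].
    by have := h 1%N isT k; rewrite gap_vadd psumSl psum0 addr0.
  by rewrite gap_vadd -addrA -psumSl; apply: h.
move=> [//|[|m]] mn k; first by rewrite psumSl psum0 addr0 -gap_vadd.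
by rewrite psumSl addrA -gap_vadd; apply: h.
Qed.

(** Index i of the longer path is index i - 1 after the first step. Hence a = 1 before the step
    corresponds to a = 0 after it: the starting time 0 of the longer path is not tested. *)
Lemma forwardS {R : realType} n (x : 3.-tuple R) e :
  forward 1 n.+1 (gap x) e <->
  Weyl (vadd x (e 0%N)) /\ forward 0 n (gap (vadd x (e 0%N))) (e \o succn).
Proof.
split=> [[/survivesS[W h1] h2]|[W [h1 h2]]].
  do 2 split=> //; move=> i /andP[_ ni] h.
  by apply: (h2 i.+1) => [//|k [//|m] im]; rewrite !psumSl ltrD2l; exact: h.
split=> [|[//|i] ni h]; first exact/survivesS.
apply: (h2 i) => [//|k m im].
by have := h k m.+1 im; rewrite !psumSl ltrD2l.
Qed.

(** If time n + 1 is a record, [near_max] holds even with 0 in place of y, and conversely y > 0 in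
    the chamber. The additional event is {J = n + 1}, whatever x is. *)
Lemma backward1P {R : realType} n (x : 3.-tuple R) e : Weyl x ->
  backward 1 n.+1 (gap x) e <->
  backward 0 n.+1 (gap x) e \/ backward 1 n.+1 (gap origin) e.
Proof.
move=> /WeylP W; split=> [[h1 h2]|[]].
- have [rn|nrn] := pselect (is_record e n.+1).
    by right; split=> [k j jn|//]; rewrite gap_origin subr_lt0; exact: rn.
  left; split=> // m m0; rewrite addn0 leq_eqVlt => /predU1P[->//|mn].
  by apply: h2 => //; rewrite addn1.
- by move=> [h1 h2]; split=> // m m0 mn; apply: h2 => //; lia.
- move=> [h1 h2]; split=> // k j jn.
  by have := h1 k j jn; rewrite gap_origin; have := W k; lra.
Qed.

Section killed_step_identity.
Context {d} {T : measurableType d} {R : realType} (P : probability T R).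
Variable xi : nat -> {RV P >-> 3.-tuple R}.
Hypothesis hiid : iid xi.
Implicit Types (x : 3.-tuple R) (t : T).

Let X t j := xi j t.

Lemma prob_backward1 n x : Weyl x -> prob_backward xi 1 n.+1 x =
  prob_backward xi 0 n.+1 x + first_record_prob xi n.+1.
Proof.
move=> Wx; rewrite /first_record_prob /prob_backward -measureU//.
- by congr (P _); apply/seteqP; split=> t /(backward1P _ _ Wx).
- exact: measurable_backward_walk.
- exact: measurable_backward_walk.
- rewrite -subset0 => t [[_ /(_ n.+1 isT)]]; rewrite addn0 => /(_ (leqnn _)) nr.
  move=> [h _]; apply: nr => k j jn.
  by have := h k j jn; rewrite gap_origin subr_lt0.
Qed.

Lemma measurable_prob_backward a n :
  measurable_fun setT (fun x => prob_backward xi a n x).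
Proof.
pose A := [set z : 3.-tuple R * T | backward a n (gap z.1) (X z.2)].
have mA : measurable A.
  apply: (@measurable_backward _ _ _ fst (fun z => X z.2)) => // j.
  exact: (measurableT_comp (measurable_xi j)).
have := measurable_fun_xsection P mA.
congr (measurable_fun _ _); apply/funext => x /=; congr (P _).
by apply/seteqP; split=> t; rewrite /xsection /= inE.
Qed.

Lemma measurable_hup : measurable_fun setT (hup xi).
Proof.
rewrite (_ : hup xi = fun x => \sum_(n <oo | n \in xpredT) prob_backward xi 0 n x).
  apply: ge0_emeasurable_sum => [n x _ _|n _]; first exact: prob_backward_ge0.
  exact: measurable_prob_backward.
by apply/funext => x; rewrite hupE.
Qed.

Lemma hup_ge0 x : 0 <= hup xi x.
Proof. by rewrite hupE; apply: nneseries_ge0 => n _ _; exact: prob_backward_ge0. Qed.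

Lemma measurable_first x : measurable_fun setT (fun t => vadd x (xi 0%N t)).
Proof. by apply: measurable_vadd => //; exact: measurable_xi. Qed.

Lemma exit_time_gt1 x :
  [set t | 1 < exit_time (walk xi x t)] = [set t | Weyl (vadd x (xi 0%N t))].
Proof.
apply/seteqP; split=> t /=.
  rewrite -[1]/(1%:R%:E) => /exit_timeP/(_ 1%N isT) h.
  by apply/WeylP => k; rewrite gap_vadd; have := h k; rewrite psumSl psum0 addr0.
move=> /WeylP h; rewrite -[1]/(1%:R%:E); apply/exit_timeP => -[|[|//]] // _ k.
by rewrite psumSl psum0 addr0 -gap_vadd.
Qed.

Lemma measurable_survive1 x : measurable [set t | Weyl (vadd x (xi 0%N t))].
Proof. by apply: measurable_Weyl; exact: measurable_first. Qed.

Lemma killed_stepE h x : killed_step xi h x =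
  \int[P]_(t in [set t | Weyl (vadd x (xi 0%N t))]) h (vadd x (xi 0%N t)).
Proof.
rewrite /killed_step exit_time_gt1; apply: eq_integral => t _.
by rewrite walkE path1.
Qed.

Lemma integral_first_step n x (g : 3.-tuple R -> (nat -> 3.-tuple R) -> \bar R) :
    (forall v e e', (forall j, (j < n)%N -> e j = e' j) -> g v e = g v e') ->
    (forall v e, 0 <= g v e) ->
    measurable_fun setT (fun z : 3.-tuple R * n.-tuple (3.-tuple R) =>
      g z.1 (seq_of z.2)) ->
  \int[P]_(t in [set t | Weyl (vadd x (xi 0%N t))])
      g (vadd x (xi 0%N t)) (X t \o succn) =
  \int[P]_(t in [set t | Weyl (vadd x (xi 0%N t))])
      \int[P]_s g (vadd x (xi 0%N t)) (X s).
Proof.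
move=> gn g0 mg; rewrite integral_mkcond [RHS]integral_mkcond.
(* Extending by 0 off the chamber turns the integral into one over the whole space. *)
pose f v e := if `[< Weyl (vadd x v) >] then g (vadd x v) e else 0.
transitivity (\int[P]_t f (xi 0%N t) (X t \o succn)).
  apply: eq_integral => t _; rewrite patchE /f; case: asboolP => W.
    by rewrite mem_set.
  by rewrite memNset.
rewrite (ge0_integral_first_step_seq hiid (n := n)).
- apply: eq_integral => t _; rewrite patchE /f.
  case: asboolP => W; first by rewrite mem_set.
  by rewrite memNset// integral0.
- by move=> v e e' ee; rewrite /f (gn _ _ _ ee).
- by move=> v e; rewrite /f; case: ifP.
- have mv : measurable_fun setT
      (fun z : 3.-tuple R * n.-tuple (3.-tuple R) => vadd x z.1).
    exact: measurable_vadd.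
  have mW := measurable_Weyl mv.
  rewrite (_ : (fun _ => _) =
    (fun z : 3.-tuple R * n.-tuple (3.-tuple R) => g (vadd x z.1) (seq_of z.2))
      \_ [set z | Weyl (vadd x z.1)]).
    apply/(measurable_restrictT _ mW); apply: measurable_funTS.
    have mz : measurable_fun setT
        (fun z : 3.-tuple R * n.-tuple (3.-tuple R) => (vadd x z.1, z.2)).
      exact: measurable_fun_pair.
    exact: (measurableT_comp mg mz).
  apply/funext => z; rewrite patchE /f; case: asboolP => W; first by rewrite mem_set.
  by rewrite memNset.
Qed.

(** Reversal replaces the probability by that of [forward], where the first step can be glued on in
    front by [forwardS]; a second reversal, of n + 1 increments, returns to [backward]. *)
Lemma integral_prob_backward0 n x :
  \int[P]_(t in [set t | Weyl (vadd x (xi 0%N t))])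
     prob_backward xi 0 n (vadd x (xi 0%N t)) = prob_backward xi 1 n.+1 x.
Proof.
pose g (z : 3.-tuple R) (e : nat -> 3.-tuple R) : \bar R :=
  (\1_[set w | forward 0 n (gap z) w] e)%:E.
have mF z : measurable [set t | forward 0 n (gap z) (X t)].
  by apply: (@measurable_forward _ _ _ (cst z)) => // j; exact: measurable_xi.
have mF1 : measurable [set t | forward 1 n.+1 (gap x) (X t)].
  by apply: (@measurable_forward _ _ _ (cst x)) => // j; exact: measurable_xi.
have gE z (A : T -> nat -> 3.-tuple R) t :
    g z (A t) = (\1_[set s | forward 0 n (gap z) (A s)] t)%:E.
  by rewrite /g !indicE; congr (nat_of_bool _)%:R%:E; apply/idP/idP; rewrite !inE.
transitivity (\int[P]_(t in [set t | Weyl (vadd x (xi 0%N t))])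
      \int[P]_s g (vadd x (xi 0%N t)) (X s)).
  apply: eq_integral => t _; rewrite /prob_backward -prob_forward//.
  under eq_integral do rewrite (gE _ X).
  by rewrite integral_indic// setIT.
rewrite -(@integral_first_step n)//.
- rewrite /prob_backward -prob_forward// -[in RHS](setIT (mkset _)).
  rewrite -integral_indic// [LHS]integral_mkcond; apply: eq_integral => t _.
  rewrite patchE /g !indicE; have [W|W] := pselect (Weyl (vadd x (xi 0%N t))).
    rewrite mem_set//; congr (nat_of_bool _)%:R%:E; apply/idP/idP; rewrite !inE.
      by move=> f; apply/forwardS.
    by move=> /forwardS[].
  by rewrite !memNset// => /forwardS[].
- move=> v e e' ee; rewrite /g !indicE; congr (nat_of_bool _)%:R%:E.
  by apply/idP/idP; rewrite !inE; apply: eq_forward => // j jn; rewrite ee.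
- by move=> v e; rewrite /g lee_fin.
- rewrite (_ : (fun z : 3.-tuple R * n.-tuple (3.-tuple R) =>
    g z.1 (seq_of z.2)) = EFin \o
    \1_[set z : 3.-tuple R * n.-tuple (3.-tuple R) |
        forward 0 n (gap z.1) (seq_of z.2)]).
    apply/measurable_EFinP; apply: measurable_indic.
    apply: measurable_forward => // j.
    exact: (measurableT_comp (@measurable_seq_of _ n j)
      (@measurable_snd _ _ (3.-tuple R) (n.-tuple (3.-tuple R)))).
  by apply/funext => z; rewrite /g /= !indicE; congr (nat_of_bool _)%:R%:E.
Qed.

(** The identity E_x(h(X_1); tau > 1) + 1 = h(x) + P(J < oo). The 1 is added rather than subtracted
    since h may take the value +oo. *)
Lemma killed_step_hup x : Weyl x ->
  killed_step xi (hup xi) x + 1 =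
  hup xi x + \sum_(n <oo) first_record_prob xi n.+1.
Proof.
move=> Wx.
have F0 a n y : 0 <= prob_backward xi a n y by exact: prob_backward_ge0.
have -> : killed_step xi (hup xi) x = \sum_(n <oo) prob_backward xi 1 n.+1 x.
  rewrite killed_stepE; under eq_integral do rewrite hupE.
  rewrite integral_nneseries//; last 2 first.
  - exact: measurable_survive1.
  - move=> n; apply: measurable_funTS.
    apply: (measurableT_comp (measurable_prob_backward 0 n)).
    exact: measurable_first.
  by apply: eq_eseriesr => n _; rewrite integral_prob_backward0.
under eq_eseriesr do rewrite prob_backward1//.
rewrite nneseriesD => [|n _ _|n _ _]; [|exact: F0|exact: F0].
(* The term n = 0 of h(x) equals 1 and matches the 1 on the left. *)
rewrite hupE [in RHS]nneseries_recl// -(@nneseries_addn _ _ 1)//.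
under [X in _ = _ + X + _]eq_eseriesr do rewrite addn1.
by rewrite prob_backward00 addeC addeA.
Qed.

End killed_step_identity.

(** * The renewal equation for joint records *)

Definition first_record {R : realType} (e : nat -> 3.-tuple R) n :=
  is_record e n /\ forall m, (0 < m < n)%N -> ~ is_record e m.

Lemma first_recordP {R : realType} (e : nat -> 3.-tuple R) n :
  backward 1 n (gap origin) e <-> first_record e n.
Proof.
split=> -[h1 h2]; split.
- by move=> k j jn; have := h1 k j jn; rewrite gap_origin subr_lt0.
- by move=> m /andP[m0 mn]; apply: h2; rewrite ?addn1.
- by move=> k j jn; rewrite gap_origin subr_lt0; exact: h1.
- by move=> m m0 mn; apply: h2; lia.
Qed.

Lemma first_record_inj {R : realType} (e : nat -> 3.-tuple R) m n :
  (0 < m)%N -> (0 < n)%N -> first_record e m -> first_record e n -> m = n.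
Proof.
move=> m0 n0 [rm hm] [rn hn]; have [mn|nm|//] := ltngtP m n.
  by exfalso; apply: (hn m) => //; rewrite m0.
by exfalso; apply: (hm n) => //; rewrite n0.
Qed.

Lemma is_record_first {R : realType} (e : nat -> 3.-tuple R) n :
  (0 < n)%N -> is_record e n ->
  exists m, [/\ (0 < m)%N, (m <= n)%N & first_record e m].
Proof.
move=> n0 rn.
have exQ : exists i, (0 < i)%N && `[< is_record e i >].
  by exists n; rewrite n0; apply/asboolP.
case: (ex_minnP exQ) => m /andP[m0 /asboolP rm] mmin; exists m; split => //.
  by apply: mmin; rewrite n0; apply/asboolP.
split=> // i /andP[i0 im] ri.
have : (m <= i)%N by apply: mmin; rewrite i0; apply/asboolP.
by rewrite leqNgt im.
Qed.

(** Values before time m lie below Y_m, so only the values from time m on can prevent a later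
    record. *)
Lemma is_record_after {R : realType} (e : nat -> 3.-tuple R) m k :
  is_record e m -> is_record e (m + k) <-> is_record (e \o addn m) k.
Proof.
move=> rm; split=> [h i j jk|h i j jmk].
  have := h i (m + j)%N; rewrite ltn_add2l !psumD ltrD2l; exact.
have [jm|mj] := ltnP j m.
  have := rm i j jm; rewrite psumD.
  (* For k = 0 the claim is the record at m; otherwise time 0 of the restarted walk gives Y_(m+k) >
     Y_m. *)
  case: k h {jmk} => [|k] h; first by rewrite psum0 addr0.
  by have := h i 0%N isT; rewrite psum0; lra.
rewrite -(subnKC mj) !psumD ltrD2l; apply: h; lia.
Qed.

Section renewal.
Context {d} {T : measurableType d} {R : realType} (P : probability T R).
Variable xi : nat -> {RV P >-> 3.-tuple R}.
Hypothesis hiid : iid xi.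
Implicit Types (x : 3.-tuple R) (t : T).

Let X t j := xi j t.
Let f := first_record_prob xi.
Let r := record_prob xi.

Let FR m := [set t | first_record (X t) m].

Let FRE m : FR m = [set t | backward 1 m (gap origin) (X t)].
Proof. by apply/seteqP; split=> t /first_recordP. Qed.

Let mFR m : measurable (FR m).
Proof. by rewrite FRE; exact: measurable_backward_walk. Qed.

Let Rec n := [set t | is_record (X t) n].

Let RecE n : Rec n = [set t | backward n n (gap origin) (X t)].
Proof. by apply/seteqP; split=> t /backward_diag. Qed.

Let mRec n : measurable (Rec n).
Proof. by rewrite RecE; exact: measurable_backward_walk. Qed.

Let f0 n : 0 <= f n. Proof. exact: measure_ge0. Qed.
Let r0 n : 0 <= r n. Proof. exact: measure_ge0. Qed.

(* P(J < oo), as the sum of the P(J = n) over n >= 1. *)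
Definition ever_record_prob : \bar R := \sum_(n <oo) first_record_prob xi n.+1.

Let p : \bar R := ever_record_prob.

Let trivIset_FR : trivIset setT (fun m => FR m.+1).
Proof.
apply/trivIsetP => i j _ _ /eqP ij; rewrite -subset0 => t [hi hj].
by have [/ij] := @first_record_inj _ _ i.+1 j.+1 isT isT hi hj.
Qed.

Let fE m : f m = P (FR m). Proof. by rewrite FRE. Qed.

Let rE m : r m = P (Rec m). Proof. by rewrite RecE. Qed.

Lemma ever_record_prob_le1 : ever_record_prob <= 1.
Proof.
rewrite /ever_record_prob (@eq_eseriesr _ _ (fun m => P (FR m.+1))); last first.
  by move=> m _; rewrite -fE.
rewrite -measure_semi_bigcup//; last exact: bigcupT_measurable.
by apply: probability_le1; exact: bigcupT_measurable.
Qed.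

Lemma ever_record_prob_ge0 : 0 <= ever_record_prob.
Proof. by apply: nneseries_ge0 => n _ _; exact: f0. Qed.

(** P(J = m + 1 and n + 1 is a record), with both indices shifted by one. *)
Let a m n := P (FR m.+1 `&` Rec n.+1).

Let a0 m n : 0 <= a m n. Proof. exact: measure_ge0. Qed.

Let a_lt m n : (n < m)%N -> a m n = 0.
Proof.
move=> nm; rewrite /a (_ : _ `&` _ = set0) ?measure0//.
by rewrite -subset0 => t [[_ h] rn]; exact: (h n.+1).
Qed.

Let aD m k : a m (m + k) = f m.+1 * r k.
Proof.
have := prob_backward_block hiid 1 m.+1 origin k k origin.
rewrite /f /r /first_record_prob /record_prob /prob_backward => <-.
rewrite -FRE; congr (P _); apply/seteqP; split=> t [h1 h2]; split=> //.
  by apply/backward_diag/is_record_after; [exact: h1.1|exact: h2].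
by move/backward_diag/(is_record_after _ h1.1) : h2.
Qed.

Let record_decomp n : r n.+1 = \sum_(m <oo) a m n.
Proof.
rewrite rE (_ : Rec n.+1 = \bigcup_m (FR m.+1 `&` Rec n.+1)).
  rewrite measure_semi_bigcup//.
  - by move=> m; exact: measurableI.
  - apply/trivIsetP => i j _ _ /eqP ij; rewrite -subset0 => t [[hi _] [hj _]].
    by have [/ij] := @first_record_inj _ _ i.+1 j.+1 isT isT hi hj.
  - by apply: bigcupT_measurable => m; exact: measurableI.
apply/seteqP; split=> [t rn|t [m _ []]//].
have [m [m0 _ fm]] := @is_record_first _ _ n.+1 isT rn.
by exists m.-1 => //; split=> //; rewrite prednK.
Qed.

Let record0 : r 0 = 1.
Proof.
rewrite rE (_ : Rec 0 = setT) ?probability_setT//.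
by apply/seteqP; split=> t // _ k j.
Qed.

Let f_fin n : f n \is a fin_num.
Proof. by rewrite fE fin_num_measure. Qed.

Let sum_fM (u : R) : \sum_(m <oo) f m.+1 * u%:E = p * u%:E.
Proof.
by under eq_eseriesr do rewrite muleC; rewrite nneseriesZl// muleC.
Qed.

(** Splitting at the first record gives r_(n+1) as the sum over m <= n of P(J = m + 1) r_(n-m);
    exchanging the two sums produces the product. Finiteness lets the total be factored out as a
    real number. *)
Let renewal_eq : \sum_(n <oo) r n < +oo ->
  \sum_(n <oo) r n = 1 + p * \sum_(n <oo) r n.
Proof.
have U0 : 0 <= \sum_(n <oo) r n by apply: nneseries_ge0 => n _ _; exact: r0.
move=> Uoo; have /fineK Ufin : \sum_(n <oo) r n \is a fin_num.
  by rewrite ge0_fin_numE.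
rewrite [LHS]nneseries_recl// record0 -(@nneseries_addn _ _ 1)//; congr (_ + _).
rewrite [LHS](@eq_eseriesr _ _ (fun n => \sum_(m <oo) a m n)) => [|n _]; last first.
  by rewrite addn1 record_decomp.
rewrite nneseries_interchange// -Ufin -sum_fM; apply: eq_eseriesr => m _.
rewrite (@nneseries_split _ _ 0 m)// add0n big1_seq ?add0e; last first.
  by move=> n; rewrite mem_index_iota/= => nm; rewrite a_lt.
rewrite -nneseries_addn// [LHS](@eq_eseriesr _ _ (fun k => f m.+1 * r k)).
  by rewrite -(fineK (f_fin m.+1)) nneseriesZl ?Ufin// fineK.
by move=> k _; rewrite addnC aD.
Qed.

(** Partial sums are always finite, so this version can bound the series without presupposing its
    convergence. *)
Let partial_renewal N :
  \sum_(0 <= n < N) r n <= 1 + p * \sum_(0 <= n < N) r n.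
Proof.
case: N => [|N]; first by rewrite big_geq// mule0 adde0.
have s0 k : 0 <= \sum_(0 <= n < k) r n by apply: sume_ge0.
have /fineK Ufin : \sum_(0 <= n < N.+1) r n \is a fin_num.
  by apply/sum_fin_numP => n _ _; rewrite rE fin_num_measure.
rewrite {1}big_nat_recl// record0 leeD2l//.
under eq_bigr do rewrite record_decomp.
rewrite -nneseries_sum// -Ufin -sum_fM; apply: lee_nneseries => [m _ _|m _].
  by apply: sume_ge0 => n _; exact: a0.
(* A first record at m + 1 > N contributes nothing; otherwise N - m terms r_0, r_1, ... remain,
   which are at most the first N + 1. *)
rewrite Ufin; have [Nm|mN] := leqP N m.
  rewrite big_nat_cond big1 ?mule_ge0// => n /andP[/andP[_ nN] _].
  by rewrite a_lt// (leq_trans nN).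
rewrite (@big_cat_nat _ _ _ m)//= ?(ltnW mN)// big_nat_cond big1 ?add0e; last first.
  by move=> n /andP[/andP[_ nm] _]; rewrite a_lt.
rewrite -[X in \sum_(X <= _ < _) _]add0n big_addn.
under eq_bigr do rewrite addnC aD.
rewrite -ge0_sume_distrr//; apply: lee_wpmul2l => //.
by apply: lee_sum_nneg_natr => //; lia.
Qed.

(** Let U be the series and p = P(J < oo). If p < 1, every partial sum is at most 1 / (1 - p). If p
    = 1 and U were finite, then U = 1 + U. *)
Lemma series_record_infty :
  \sum_(n <oo) record_prob xi n = +oo <-> ever_record_prob = 1.
Proof.
have nofix (u : R) : u <> (1 + u)%R by lra.
have p1 := ever_record_prob_le1; have p0 := ever_record_prob_ge0.
have pfin : p \is a fin_num by rewrite ge0_fin_numE// (le_lt_trans p1) ?ltry.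
have U0 : 0 <= \sum_(n <oo) r n by apply: nneseries_ge0 => n _ _; exact: r0.
split=> [Uoo|pe1].
  apply/eqP; rewrite eq_le p1/= leNgt; apply/negP => p_lt1.
  suff : \sum_(n <oo) r n <= ((1 - fine p)^-1)%:E by rewrite Uoo leye_eq.
  apply: lime_le; first by apply: is_cvg_nneseries.
  apply: nearW => N.
  have /fineK Ufin : \sum_(0 <= n < N) r n \is a fin_num.
    by apply/sum_fin_numP => n _ _; rewrite rE fin_num_measure.
  have := partial_renewal N; rewrite -Ufin -(fineK pfin) -EFinM -EFinD !lee_fin.
  have : (fine p < 1)%R by rewrite -lte_fin fineK.
  move=> fp1 h; rewrite -[leRHS]mul1r ler_pdivlMr ?subr_gt0//; lra.
have [//|Uoo] := eqVneq (\sum_(n <oo) record_prob xi n) +oo.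
have Ult : \sum_(n <oo) r n < +oo by rewrite ltey.
have := renewal_eq Ult; rewrite /p pe1 mul1e.
have /fineK <- : \sum_(n <oo) r n \is a fin_num by rewrite ge0_fin_numE.
by rewrite -EFinD => -[/nofix].
Qed.

End renewal.

(** * Finiteness *)

Lemma psum_growth {R : realType} (e : nat -> 3.-tuple R) (k : 'I_2) (c : R) n m :
    (forall i, (n <= i < n + m)%N -> (c < tnth (gap (e i)) k)%R) ->
  (psum e k n + c *+ m <= psum e k (n + m))%R.
Proof.
elim: m => [|m IH] h; first by rewrite mulr0n addr0 addn0.
have := IH (fun i ni => h i ltac:(lia)).
have := h (n + m)%N ltac:(lia).
rewrite addnS psumS mulrSr; lra.
Qed.

(** At time n both coordinates are within y of their past maxima; m steps larger than c raise each
    by at least c m >= y, so n + m is a record. The first record thus lies in (n, n + m]. *)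
Lemma first_record_after_rise {R : realType} (e : nat -> 3.-tuple R)
    (y : 2.-tuple R) (c : R) n m :
    near_max y e n -> no_record e n -> (0 < m)%N -> (0 < c)%R ->
    (forall i, (i < m)%N -> forall k : 'I_2, (c < tnth (gap (e (n + i)%N)) k)%R) ->
    (forall k, (tnth y k <= c *+ m)%R) ->
  exists2 i, (i < m)%N & first_record e (n + i.+1).
Proof.
move=> ny nr m0 c0 rise ym.
have growth (k : 'I_2) i l : (n <= i)%N -> (i + l <= n + m)%N ->
    (psum e k i + c *+ l <= psum e k (i + l))%R.
  move=> ni ilm; apply: psum_growth => u iul.
  by rewrite -(@subnKC n u); [apply: rise; lia|lia].
have r : is_record e (n + m).
  move=> k j jnm; have [jn|nj] := ltnP j n.
    by have := ny k j jn; have := ym k; have := growth k n m (leqnn _) (leqnn _); lra.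
  have := growth k j (n + m - j)%N nj; rewrite (subnKC (ltnW jnm)) => /(_ (leqnn _)).
  have : (0 < c *+ (n + m - j))%R by rewrite pmulrn_lgt0// subn_gt0.
  by lra.
have [i [i0 inm fi]] := is_record_first (ltn_addl n m0) r.
have ni : (n < i)%N.
  by rewrite ltnNge; apply/negP => ni; apply: (nr i) => //; [rewrite i0|exact: fi.1].
exists (i - n).-1; first lia.
by rewrite prednK ?subn_gt0// subnKC// ltnW.
Qed.

Section finiteness.
Context {d} {T : measurableType d} {R : realType} (P : probability T R).
Variable xi : nat -> {RV P >-> 3.-tuple R}.
Hypothesis hiid : iid xi.
Implicit Types (x : 3.-tuple R) (t : T).

Let X t j := xi j t.

Let steep (c : R) : set (3.-tuple R) :=
  [set v | forall k : 'I_2, (c < tnth (gap v) k)%R].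

Let measurable_steep c : measurable (steep c).
Proof.
by apply: measurable_forall_fin => k; apply: measurable_lt => //; exact: measurable_gap.
Qed.

(** The event Y_1 > 0 is the countable union of the events Y_1 > 1 / (j + 1), which cannot all be
    null. *)
Let steep_pos : P [set t | Weyl (walk xi origin t 1)] <> 0 ->
  exists2 c : R, (0 < c)%R & 0 < P (xi 0%N @^-1` steep c).
Proof.
move=> W0; apply: contrapT => nc; apply: W0.
have P0 j : P (xi 0%N @^-1` steep j.+1%:R^-1) = 0.
  apply/eqP; rewrite eq_le measure_ge0 andbT leNgt; apply/negP => Pj.
  by apply: nc; exists (j.+1%:R^-1)%R => //; rewrite invr_gt0.
have mS j : measurable (xi 0%N @^-1` steep j.+1%:R^-1).
  rewrite -[X in measurable X]setTI; exact: (measurable_xi 0%N).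
have : P.-negligible (\bigcup_j (xi 0%N @^-1` steep j.+1%:R^-1)).
  by apply: negligible_bigcup => j; apply/negligibleP; [exact: mS|exact: P0].
move=> /(negligibleP P (bigcupT_measurable _ mS)) <-.
congr (P _); apply/seteqP; split=> t.
  rewrite /= walkE path1 => /WeylP W.
  pose c := Num.min (tnth (gap (xi 0%N t)) 0%R) (tnth (gap (xi 0%N t)) 1%R).
  have c0 : (0 < c)%R.
    rewrite lt_min; have := W 0%R; have := W 1%R.
    by rewrite !gap_vadd !gap_origin !add0r => -> ->.
  (* With j = floor(1 / c), where c is the smaller gap, 1 / (j + 1) < c. *)
  exists (Num.truncn c^-1) => // k.
  have cj : ((Num.truncn c^-1).+1%:R^-1 < c)%R.
    by rewrite invf_plt ?posrE// truncnS_gt.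
  apply: lt_le_trans cj _.
  by move: k; apply/I2P; rewrite /c !ge_min !lexx orbT.
move=> [j _ h] /=; rewrite walkE path1; apply/WeylP => k.
by rewrite gap_vadd gap_origin add0r (lt_trans _ (h k))// invr_gt0.
Qed.

(** Let q be the probability of a steep step. The n-th event of h followed by m steep steps forces n
    < J <= n + m; summing over n counts each value of J at most m times, whence q^m h(x) <= m. *)
Lemma hup_lty x : P [set t | Weyl (walk xi origin t 1)] <> 0 -> hup xi x < +oo.
Proof.
move=> /steep_pos[c c0 Pc].
have [m [m0 ym]] : exists m, (0 < m)%N /\ forall k, (tnth (gap x) k <= c *+ m)%R.
  pose b := Num.max (tnth (gap x) 0%R) (tnth (gap x) 1%R).
  (* More than b / c steps of size c cover the larger gap b. *)
  exists (Num.truncn (b / c)).+1; split=> // k.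
  have : (b <= c *+ (Num.truncn (b / c)).+1)%R.
    by rewrite -mulr_natr mulrC -ler_pdivrMr// ltW// truncnS_gt.
  apply: le_trans; move: k; apply/I2P; rewrite /b !le_max !lexx orbT.
  by split.
pose q := fine (P (xi 0%N @^-1` steep c)).
have mS : measurable (xi 0%N @^-1` steep c).
  rewrite -[X in measurable X]setTI; exact: (measurable_xi 0%N).
have qE : P (xi 0%N @^-1` steep c) = q%:E by rewrite fineK// fin_num_measure.
have q0 : (0 < q)%R by rewrite -lte_fin -qE.
have prodE : \prod_(0 <= i < m) P (xi 0%N @^-1` steep c) = (q ^+ m)%:E.
  by rewrite qE prodEFin prodr_const_nat subn0.
(* The m steps after time n are independent of the n-th event, so the left side is the probability
   of both; the right side sums P(J = n + i + 1) over i < m. *)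
have step n : prob_backward xi 0 n x * (q ^+ m)%:E <=
    \sum_(0 <= i < m) first_record_prob xi (n + i).+1.
  rewrite -prodE -(prob_backward_box hiid 0 n x m (fun=> measurable_steep c)).
  apply: (@le_trans _ _
    (\sum_(i < m) P [set t | first_record (X t) (n + i).+1])); last first.
    rewrite big_mkord; apply: lee_sum => i _; rewrite le_eqVlt; apply/orP; left.
    by apply/eqP; congr (P _); apply/seteqP; split=> t /first_recordP.
  apply: (@content_subadditive _ _ _ P _
    (fun i => [set t | first_record (X t) (n + i).+1])).
  - move=> i _.
    rewrite (_ : mkset _ = [set t | backward 1 (n + i).+1 (gap origin) (X t)]).
      exact: measurable_backward_walk.
    by apply/seteqP; split=> t /first_recordP.
  - apply: measurableI; first exact: measurable_backward_walk.
    apply: measurable_forall_nat => i; apply: measurable_imply.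
    rewrite -[X in measurable X]setTI; exact: (measurable_xi (n + i)%N).
  - move=> t [/backward0P[h1 h2] h3]; rewrite
      -(bigcup_mkord m (fun i => [set t | first_record (X t) (n + i).+1])).
    have [i im fi] := first_record_after_rise h1 h2 m0 c0 h3 ym.
    by exists i => //=; rewrite -addnS.
have le_m : (q ^+ m)%:E * hup xi x <= m%:R%:E.
  rewrite hupE -nneseriesZl; last by move=> n _; exact: prob_backward_ge0.
  apply: (@le_trans _ _
    (\sum_(n <oo) \sum_(0 <= i < m) first_record_prob xi (n + i).+1)).
    apply: lee_nneseries => [n _ _|n _]; last by rewrite muleC.
    by rewrite mule_ge0 ?prob_backward_ge0// lee_fin exprn_ge0// ltW.
  have f0 n : 0 <= first_record_prob xi n by exact: measure_ge0.
  rewrite nneseries_sum_nat//.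
  apply: (@le_trans _ _ (\sum_(0 <= i < m) 1%:E)); last first.
    by rewrite sumEFin sumr_const_nat subn0.
  apply: lee_sum => i _; apply: le_trans (ever_record_prob_le1 xi).
  rewrite (@nneseries_addn _ (fun n => first_record_prob xi n.+1) i)//.
  rewrite /ever_record_prob (@nneseries_split _ _ 0 i)// add0n leeDr//.
  exact: sume_ge0.
have h0 := hup_ge0 xi x.
rewrite ltey; apply: contraTneq le_m => ->.
by rewrite gt0_muley ?lte_fin ?exprn_gt0// leye_eq.
Qed.

End finiteness.

(** * Iterating the killed step *)

Lemma patch_asboolE {T : Type} {R : realType} (f : T -> \bar R) (D : set T) t :
  (f \_ D) t = if `[< D t >] then f t else 0.
Proof.
rewrite patchE; case: asboolP => Dt; first by rewrite mem_set.
by rewrite memNset.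
Qed.

(** Compares integrals on two different spaces: only the joint law of the value and of the survival
    event matters. *)
Lemma integral_joint_law {d1 d2 d'} {T1 : measurableType d1}
    {T2 : measurableType d2} {V : measurableType d'} {R : realType}
    (m1 : {measure set T1 -> \bar R}) (m2 : {measure set T2 -> \bar R})
    (U1 : T1 -> V) (U2 : T2 -> V) (E1 : set T1) (E2 : set T2) (h : V -> \bar R) :
    measurable_fun setT U1 -> measurable_fun setT U2 ->
    measurable E1 -> measurable E2 ->
    measurable_fun setT h -> (forall v, 0 <= h v) ->
    (forall A, measurable A -> m1 (U1 @^-1` A `&` E1) = m2 (U2 @^-1` A `&` E2)) ->
  \int[m1]_(t in E1) h (U1 t) = \int[m2]_(t in E2) h (U2 t).
Proof.
move=> mU1 mU2 mE1 mE2 mh h0 m12.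
(* Recording membership in E as a second coordinate moves E into the target. *)
pose D := [set z : V * bool | z.2].
have mD : measurable D.
  rewrite (_ : D = setT `*` [set true]); first exact: measurableX.
  by apply/seteqP; split=> [[v b]|[v b] []]//=.
have image d (T : measurableType d) (m : {measure set T -> \bar R}) (U : T -> V)
    (E : set T) (mU : measurable_fun setT U) (mE : measurable E) :
    exists2 m' : {measure set (V * bool) -> \bar R},
      \int[m]_(t in E) h (U t) = \int[m']_(z in D) h z.1 &
      forall A, measurable A -> A `<=` D ->
        m' A = m (U @^-1` ysection A true `&` E).
  have mphi : measurable_fun setT (fun t => (U t, `[< E t >])).
    apply: measurable_fun_pair => //; apply: (measurable_fun_bool true).
    rewrite setTI (_ : _ @^-1` _ = E)//.
    by apply/seteqP; split=> t /= /asboolP.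
  exists (image_measure m mphi).
    rewrite [RHS](ge0_integral_pushforward mphi)//; last first.
      by apply: measurable_funTS; exact: (measurableT_comp mh measurable_fst).
    rewrite (_ : _ @^-1` D = E)//.
    by apply/seteqP; split=> t /= /asboolP.
  move=> A mA AD; rewrite /= /pushforward; congr (m _).
  apply/seteqP; split=> t /=; rewrite /ysection /= inE; last first.
    by move=> [At Et]; rewrite asboolT.
  move=> At; have /= /asboolP Et := AD _ At; split=> //.
  by rewrite asboolT in At.
have [m1' -> m1'E] := image _ _ m1 U1 E1 mU1 mE1.
have [m2' -> m2'E] := image _ _ m2 U2 E2 mU2 mE2.
apply: eq_measure_integral => A mA AD; rewrite m1'E// m2'E//; apply: m12.
exact: measurable_ysection.
Qed.

Section killed_iterates.
Context {d} {T : measurableType d} {R : realType} (P : probability T R).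
Variable xi : nat -> {RV P >-> 3.-tuple R}.
Hypothesis hiid : iid xi.
Variable h : 3.-tuple R -> \bar R.
Hypotheses (mh : measurable_fun setT h) (h0 : forall x, 0 <= h x).
Implicit Types (x : 3.-tuple R) (t : T).

Let X t j := xi j t.

(** E_x(h(X_n); tau > n), expressed on the space that carries the increments. *)
Definition killed_iterate n x :=
  \int[P]_(t in [set t | survives (gap x) (X t) n]) h (path x (X t) n).

Let S n x := [set t | survives (gap x) (X t) n].

Let mS n x : measurable (S n x).
Proof.
by apply: (@measurable_survives _ _ _ (cst x)) => // j; exact: measurable_xi.
Qed.

Lemma killed_iterate_ge0 n x : 0 <= killed_iterate n x.
Proof. by apply: integral_ge0 => t _; exact: h0. Qed.

Lemma killed_iterate0 x : killed_iterate 0 x = h x.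
Proof.
rewrite /killed_iterate (_ : mkset _ = setT).
  rewrite (eq_integral (cst (h x))) => [|t _]; last first.
    congr h; apply/eq_from_tnth => i.
    by rewrite tnth_mktuple big_geq// addr0.
  by rewrite integral_cst// [X in _ * X](probability_setT P) mule1.
by apply/seteqP; split=> t // _ [|m]; rewrite ?ltn0 ?andbF.
Qed.

Lemma measurable_killed_iterate n : measurable_fun setT (killed_iterate n).
Proof.
pose A := [set z : 3.-tuple R * T | survives (gap z.1) (X z.2) n].
have mX2 j : measurable_fun setT (fun z : 3.-tuple R * T => X z.2 j).
  exact: (measurableT_comp (measurable_xi j)).
have mA : measurable A by exact: (@measurable_survives _ _ _ fst (fun z => X z.2)).
pose g (z : 3.-tuple R * T) := h (path z.1 (X z.2) n).
have mg : measurable_fun setT g.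
  apply: (measurableT_comp mh).
  exact: (@measurable_path _ _ _ fst (fun z => X z.2)).
have mgA : measurable_fun setT (g \_ A).
  by apply/(measurable_restrictT _ mA); exact: measurable_funTS.
have gA0 z : 0 <= (g \_ A) z by rewrite patch_asboolE; case: ifP => // _; exact: h0.
rewrite (_ : killed_iterate n = fubini_F P (g \_ A)).
  exact: measurable_fun_fubini_tonelli_F.
apply/funext => x; rewrite /fubini_F /killed_iterate [LHS]integral_mkcond.
apply: eq_integral => t _.
by rewrite !patch_asboolE.
Qed.

(** The Markov property at time 1: after a first step inside the chamber, n steps of an independent
    copy remain. *)
Lemma killed_iterateS n x : killed_iterate n.+1 x =
  \int[P]_(t in [set t | Weyl (vadd x (xi 0%N t))])
     killed_iterate n (vadd x (xi 0%N t)).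
Proof.
pose g z (e : nat -> 3.-tuple R) : \bar R :=
  if `[< survives (gap z) e n >] then h (path z e n) else 0.
transitivity (\int[P]_(t in [set t | Weyl (vadd x (xi 0%N t))])
      \int[P]_s g (vadd x (xi 0%N t)) (X s)); last first.
  apply: eq_integral => t _; rewrite /killed_iterate [RHS]integral_mkcond.
  by apply: eq_integral => s _; rewrite patch_asboolE.
rewrite -(@integral_first_step _ _ _ _ _ hiid n).
- rewrite /killed_iterate [LHS]integral_mkcond [RHS]integral_mkcond.
  apply: eq_integral => t _; rewrite !patch_asboolE /= /g pathS.
  case: asboolP => [/survivesS[W s2]|s1]; first by rewrite !asboolT.
  case: asboolP => // W; case: asboolP => // s2.
  by exfalso; apply: s1; apply/survivesS.
- move=> v e e' ee; rewrite /g.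
  have -> : `[< survives (gap v) e n >] = `[< survives (gap v) e' n >].
    by apply/asbool_equiv_eq; split; apply: eq_survives => // j jn; rewrite ee.
  congr (if _ then h _ else _); apply/eq_from_tnth => i; rewrite !tnth_mktuple.
  by congr (_ + _)%R; apply: eq_big_nat => j /andP[_ jn]; rewrite ee.
- by move=> v e; rewrite /g; case: ifP.
- have msnd j : measurable_fun setT
      (fun z : 3.-tuple R * n.-tuple (3.-tuple R) => seq_of z.2 j).
    exact: (measurableT_comp (@measurable_seq_of _ n j)
      (@measurable_snd _ _ (3.-tuple R) (n.-tuple (3.-tuple R)))).
  pose A := [set z : 3.-tuple R * n.-tuple (3.-tuple R) |
    survives (gap z.1) (seq_of z.2) n].
  have mA : measurable A.
    exact: (@measurable_survives _ _ _ fst (fun z => seq_of z.2)).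
  rewrite (_ : (fun z : 3.-tuple R * n.-tuple (3.-tuple R) => g z.1 (seq_of z.2)) =
      (fun z => h (path z.1 (seq_of z.2) n)) \_ A).
    apply/(measurable_restrictT _ mA); apply: measurable_funTS.
    apply: (measurableT_comp mh).
    exact: (@measurable_path _ _ _ fst (fun z => seq_of z.2)).
  by apply/funext => z; rewrite patch_asboolE.
Qed.

Lemma killed_expectationE x (n : nat) {d'} {T' : measurableType d'}
    (Q : probability T' R) (Y : nat -> {RV Q >-> 3.-tuple R}) (zeta : T' -> \bar R) :
    measurable_fun setT zeta -> killed_law xi x Y zeta -> (0 < n)%N ->
  killed_expectation Y zeta h n = killed_iterate n x.
Proof.
move=> mz [_ law]; case: n => // n _.
have mE : measurable [set s | n.+1%:R%:E < zeta s].
  rewrite -[X in measurable X]setTI; exact: emeasurable_fun_o_infty.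
transitivity (\int[Q]_(t in [set s | n.+1%:R%:E < zeta s]) h (Y n.+1 t)).
  rewrite integral_mkcond; apply: eq_integral => t _.
  by rewrite patchE indicE; case: ifP; rewrite ?mule1 ?mule0.
apply: integral_joint_law => //.
- by apply: (@measurable_path _ _ _ (cst x)) => // j; exact: measurable_xi.
- exact: mS.
- move=> A mA.
  (* An event of X_(n+1) alone, viewed as an event of the whole tuple: its last entry is the
     position at time n + 1. *)
  pose B := (fun u : n.+1.-tuple (3.-tuple R) => tnth u ord_max) @^-1` A.
  have mB : measurable B.
    by rewrite -[X in measurable X]setTI; exact: measurable_tnth.
  transitivity (Q [set t | B [tuple Y i.+1 t | i < n.+1] /\ n.+1%:R%:E < zeta t]).
    by congr (Q _); apply/seteqP; split=> t; rewrite /B /= tnth_mktuple.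
  rewrite law//; congr (P _); apply/seteqP; split=> t; rewrite /B /= tnth_mktuple.
    by move=> [At /exit_timeP].
  by move=> [At St]; split=> //; apply/exit_timeP.
Qed.

End killed_iterates.

(** * Comparing h with its killed expectations *)

Section main.
Context {d} {T : measurableType d} {R : realType} (P : probability T R).
Variable xi : nat -> {RV P >-> 3.-tuple R}.
Hypothesis hiid : iid xi.
Implicit Types x : 3.-tuple R.

Lemma mean_exit_time_infty :
  mean_exit_time xi = +oo <-> ever_record_prob xi = 1.
Proof. by rewrite mean_exit_timeE//; exact: series_record_infty. Qed.

Lemma killed_step_hup_le x : Weyl x -> killed_step xi (hup xi) x <= hup xi x.
Proof.
move=> Wx; rewrite -(@leeD2rE _ 1)// killed_step_hup//.
by rewrite leeD2l// ever_record_prob_le1.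
Qed.

Lemma killed_step_hup_lt x : Weyl x -> hup xi x < +oo ->
  ever_record_prob xi < 1 -> killed_step xi (hup xi) x < hup xi x.
Proof.
move=> Wx hoo p1; rewrite -(@lteD2rE _ 1)// killed_step_hup//.
by rewrite lteD2lE// ge0_fin_numE// hup_ge0.
Qed.

Lemma killed_step_hup_eq x : Weyl x -> ever_record_prob xi = 1 ->
  killed_step xi (hup xi) x = hup xi x.
Proof.
move=> Wx p1; apply/eqP; rewrite eq_le killed_step_hup_le//=.
by rewrite -(@leeD2rE _ 1)// killed_step_hup// -/(ever_record_prob xi) p1.
Qed.

Let mhup := measurable_hup xi.

(** The bound is applied to the n later steps and the first step is kept apart, so that a strict
    loss in it is not forgotten. *)
Lemma killed_iterateS_hup_le n x :
    (forall z, Weyl z -> killed_iterate xi (hup xi) n z <= hup xi z) ->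
  killed_iterate xi (hup xi) n.+1 x <= killed_step xi (hup xi) x.
Proof.
move=> IH; rewrite killed_iterateS//; last by move=> ?; exact: hup_ge0.
have mv := measurable_first xi x.
rewrite killed_stepE; apply: ge0_le_integral => //.
- exact: measurable_survive1.
- by move=> t _; apply: killed_iterate_ge0 => z; exact: hup_ge0.
- have mK := measurable_killed_iterate xi mhup (hup_ge0 xi) n.
  by apply: measurable_funTS; exact: (measurableT_comp mK mv).
- by apply: measurable_funTS; exact: (measurableT_comp mhup mv).
- by move=> t Wt; exact: IH.
Qed.

Lemma killed_iterate_hup_le n x : Weyl x ->
  killed_iterate xi (hup xi) n x <= hup xi x.
Proof.
elim: n x => [|n IH] x Wx; first by rewrite killed_iterate0.
exact: le_trans (killed_iterateS_hup_le _ IH) (killed_step_hup_le Wx).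
Qed.

Lemma killed_iterate_hup_eq n x : Weyl x -> ever_record_prob xi = 1 ->
  killed_iterate xi (hup xi) n x = hup xi x.
Proof.
move=> + p1; elim: n x => [|n IH] x Wx; first by rewrite killed_iterate0.
rewrite killed_iterateS//; last by move=> ?; exact: hup_ge0.
rewrite -(killed_step_hup_eq Wx p1) killed_stepE.
by apply: eq_integral => t /set_mem Wt; exact: IH.
Qed.

(** Otherwise the walk from 0 almost surely leaves at time 1 and its exit time has finite mean. This
    supplies the finiteness of h in the harmonic case. *)
Lemma Weyl_step_pos : mean_exit_time xi = +oo ->
  P [set t | Weyl (walk xi origin t 1)] <> 0.
Proof.
move=> tau_oo W0; have := tau_oo; rewrite mean_exit_timeE//.
rewrite nneseries_recl => [|n _|//]; last exact: prob_backward_ge0.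
rewrite eseries0 ?adde0 => [|n n0 _].
  by move=> r0; have := prob_backward_le1 xi 0 0 origin; rewrite -/(record_prob xi 0) r0.
(* For n > 0, survival up to n requires the first step to lie in the chamber, a null event here;
   only the term n = 0 remains in the series. *)
rewrite record_prob_survives//; apply/eqP; rewrite -measure_le0 -W0.
apply: le_measure; rewrite ?inE.
- by apply: (@measurable_survives _ _ _ (cst origin)) => // j; exact: measurable_xi.
- by apply: measurable_Weyl; exact: (@measurable_path _ _ _ (cst origin)).
- by case: n n0 => // n _ t /survivesS[W _]; rewrite /= walkE path1.
Qed.

End main.

Theorem lemma6 (R : realType)
    (d : measure_display) (T : measurableType d) (P : probability T R)
    (xi : nat -> {RV P >-> 3.-tuple R})
    (hiid : iid xi) (hY : two_sided xi)
    (x : 3.-tuple R) (hx : Weyl x) (n : nat) (hn : (0 < n)%N)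
    (d' : measure_display) (T' : measurableType d') (Q : probability T' R)
    (X : nat -> {RV Q >-> 3.-tuple R}) (zeta : T' -> \bar R)
    (hzeta : measurable_fun setT zeta) (hQ : killed_law xi x X zeta) :
  (mean_exit_time xi < +oo ->
     walk_subharmonic xi (hup xi) /\
     ((P [set t | Weyl (walk xi origin t 1)] = 0 -> hup xi x < +oo) ->
      killed_expectation X zeta (hup xi) n < hup xi x)) /\
  (mean_exit_time xi = +oo ->
     walk_harmonic xi (hup xi) /\
     killed_expectation X zeta (hup xi) n = hup xi x).
Proof.
have h0 := hup_ge0 xi; have mh := measurable_hup xi.
rewrite (killed_expectationE mh h0 hzeta hQ hn).
split=> [tau_fin|tau_oo].
- have p1 : ever_record_prob xi < 1.
    rewrite lt_neqAle ever_record_prob_le1 andbT; apply/eqP.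
    by move=> /(mean_exit_time_infty hiid) tau_oo; rewrite tau_oo in tau_fin.
  split=> [|W0_fin].
    by split=> z Wz; [exact: h0|exact: killed_step_hup_le].
  (* Finiteness is proved when the first step from 0 enters the chamber with positive probability,
     and is the assumption [W0_fin] otherwise. *)
  have hx_fin : hup xi x < +oo.
    have [/W0_fin//|W0] := pselect (P [set t | Weyl (walk xi origin t 1)] = 0).
    exact: hup_lty.
  (* Strictness comes from the first step; the remaining steps only need the weak inequality. *)
  case: n hn => // n _; apply: le_lt_trans (killed_step_hup_lt hiid hx hx_fin p1).
  by apply: killed_iterateS_hup_le => // z; exact: killed_iterate_hup_le.
- have p1 := (mean_exit_time_infty hiid).1 tau_oo.
  split; last exact: killed_iterate_hup_eq.
  split=> z Wz; last exact: killed_step_hup_eq.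
  by rewrite h0/= hup_lty//; exact: Weyl_step_pos.
Qed.
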